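(* Let $R=\mathbb{C}[x,y,z,w]$ and let $I_3\subseteq R$ be the ideal generated by $$(x^3-y^3)(z^3-w^3)xy,\ (x^3-y^3)(z^3-w^3)zw,\ (x^3-z^3)(y^3-w^3)xz,\ (x^3-z^3)(y^3-w^3)yw,\ (x^3-w^3)(y^3-z^3)xw,\ (x^3-w^3)(y^3-z^3)yz.$$ Then (1) $\alpha(I_3^{(3m)})=18m$ for all $m\ge 1$; (2) $\alpha(I_3^{(3m+1)})=18m+8$ for all $m\ge 0$; (3) $\alpha(I_3^{(3m+2)})=18m+16$ for all $m\ge 0$.
   Context: For a homogeneous ideal $I$, $\alpha(I)$ denotes the least degree of a nonzero homogeneous element of $I$. The $m$-th symbolic power is $I^{(m)}=\bigcap_{\mathfrak p\in \operatorname{Ass}(R/I)} (I^mR_{\mathfrak p}\cap R)$, with $I^{(1)}=I$. *)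

(* Defs.v *)
From mathcomp Require Import all_boot all_algebra.
From mathcomp Require Import Rstruct.
From mathcomp Require Import complex.
From mathcomp Require Import mpoly.
Set Implicit Arguments. Unset Strict Implicit. Unset Printing Implicit Defensive.
Import GRing.Theory.
Local Open Scope ring_scope.

Definition CC : closedFieldType := complex Rdefinitions.R.

Definition R4 := {mpoly CC[4]}.

Definition vx : R4 := 'X_0.
Definition vy : R4 := 'X_1.
Definition vz : R4 := 'X_2.
Definition vw : R4 := 'X_3.

Definition is_ideal (I : R4 -> Prop) : Prop :=
  I 0 /\ (forall a b, I a -> I b -> I (a + b)) /\ (forall r a, I a -> I (r * a)).

Definition gen (S : R4 -> Prop) : R4 -> Prop :=
  fun f => exists l : seq (R4 * R4),
      (forall p, p \in l -> S p.2) /\ f = \sum_(p <- l) p.1 * p.2.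

Fixpoint idpow (I : R4 -> Prop) (m : nat) : R4 -> Prop :=
  match m with
  | 0%N => fun _ => True
  | m'.+1 => gen (fun h => exists a b, idpow I m' a /\ I b /\ h = a * b)
  end.

Definition is_prime_ideal (P : R4 -> Prop) : Prop :=
  is_ideal P /\ ~ P 1 /\ (forall a b, P (a * b) -> P a \/ P b).

Definition assoc_prime (I P : R4 -> Prop) : Prop :=
  is_prime_ideal P /\ exists g : R4, forall h, P h <-> I (h * g).

(* m-th symbolic power: intersection over P in Ass(R/I) of I^m R_P \cap R,
   where f in I^m R_P \cap R  iff  s f in I^m for some s not in P. *)
Definition symb_pow (I : R4 -> Prop) (m : nat) : R4 -> Prop :=
  fun f => forall P, assoc_prime I P -> exists s, ~ P s /\ idpow I m (s * f).

Definition alpha_is (J : R4 -> Prop) (n : nat) : Prop :=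
  (exists f, J f /\ f != 0 /\ f \is n.-homog) /\
  (forall (f : R4) (d : nat), J f -> f != 0 -> f \is d.-homog -> (n <= d)%N).

Definition I3gens : seq R4 :=
  [:: (vx^+3 - vy^+3) * (vz^+3 - vw^+3) * vx * vy;
      (vx^+3 - vy^+3) * (vz^+3 - vw^+3) * vz * vw;
      (vx^+3 - vz^+3) * (vy^+3 - vw^+3) * vx * vz;
      (vx^+3 - vz^+3) * (vy^+3 - vw^+3) * vy * vw;
      (vx^+3 - vw^+3) * (vy^+3 - vz^+3) * vx * vw;
      (vx^+3 - vw^+3) * (vy^+3 - vz^+3) * vy * vz].

Definition I3 : R4 -> Prop := gen (fun g => g \in I3gens).

(* Main.v *)
(* I3 is the radical ideal of the 42 lines of P^3 along which exactly three of the 18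
   planes x_i = c x_j (c^3 = 1) meet.

   Lower bound.  Let f vanish to order n on all the lines.  A plane x_i = c x_j contains
   seven of them and meets the coordinate line x_k = x_l = 0 in a point off those seven.
   Restricted to the plane and read as a polynomial in x_j, f has seven distinct roots of
   multiplicity n and degree at most deg f - n.  So if deg f < 8 n then f vanishes on
   every plane, hence is divisible by the product of the 18 linear forms, and the quotient
   vanishes to order n - 3 on all the lines; induct on n.

   Upper bound.  With F the product of the 18 forms and g a generator, F^m g^r works,
   provided that every associated prime of I3 lies in the ideal of a line, i.e. that I3
   contains every polynomial vanishing on the lines.  Put A = (x^3-y^3)(z^3-w^3) and
   C = (x^3-w^3)(y^3-z^3): the 36 non-coordinate lines are the complete intersection
   A = C = 0, whose ideal (A, C) is radical because each factor of A meets each factor of C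
   in a different line.  Vanishing of p A + q C on the coordinate lines is a condition on
   single monomials of p, q and p - q, which puts p A + q C in I3 because
   A + C = (x^3-z^3)(y^3-w^3). *)
Require Import Defs.
From Stdlib Require Import Classical.
From mathcomp Require Import all_boot all_algebra.
From mathcomp Require Import Rstruct complex mpoly ring zify.
Set Implicit Arguments. Unset Strict Implicit. Unset Printing Implicit Defensive.
Import GRing.Theory.
Local Open Scope ring_scope.

(** * Generated ideals and their powers *)

Lemma gen_is_ideal (S : R4 -> Prop) : is_ideal (gen S).
Proof.
split; first by exists [::]; rewrite big_nil.
split=> [a b [l [Sl ->]] [l' [Sl' ->]] | r a [l [Sl ->]]].
  exists (l ++ l'); rewrite big_cat; split=> // p.
  by rewrite mem_cat => /orP[/Sl | /Sl'].
exists [seq (r * p.1, p.2) | p <- l]; split.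
  by move=> p /mapP[q /Sl Sq ->].
by rewrite big_map mulr_sumr; apply: eq_bigr => p _; rewrite mulrA.
Qed.

Lemma gen_mem (S : R4 -> Prop) g : S g -> gen S g.
Proof.
move=> Sg; exists [:: (1, g)]; rewrite big_seq1 mul1r; split=> // p.
by rewrite inE => /eqP->.
Qed.

Lemma gen_min (S J : R4 -> Prop) :
  is_ideal J -> (forall g, S g -> J g) -> forall f, gen S f -> J f.
Proof.
move=> [J0 [JD JM]] SJ f [l [Sl ->]]; elim: l Sl => [|p l IH] Sl.
  by rewrite big_nil.
rewrite big_cons; apply: JD; first by apply/JM/SJ/Sl/mem_head.
by apply: IH => q ql; apply: Sl; rewrite inE ql orbT.
Qed.

Section IdealFacts.
Variable (J : R4 -> Prop).
Hypothesis idJ : is_ideal J.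

Lemma idealD a b : J a -> J b -> J (a + b). Proof. by case: idJ => _ [H _]; apply: H. Qed.
Lemma idealMl r a : J a -> J (r * a). Proof. by case: idJ => _ [_ H]; apply: H. Qed.
Lemma idealMr r a : J a -> J (a * r). Proof. by rewrite mulrC; apply: idealMl. Qed.
Lemma idealN a : J a -> J (- a). Proof. by rewrite -mulN1r; apply: idealMl. Qed.
Lemma idealB a b : J a -> J b -> J (a - b).
Proof. by move=> Ja Jb; apply: idealD => //; apply: idealN. Qed.
Lemma ideal_sum (T : eqType) (s : seq T) (F : T -> R4) :
  (forall i, i \in s -> J (F i)) -> J (\sum_(i <- s) F i).
Proof.
elim: s => [|i s IH] JF; first by rewrite big_nil; case: idJ.
rewrite big_cons; apply: idealD; first by apply: JF; rewrite mem_head.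
by apply: IH => k ks; apply: JF; rewrite inE ks orbT.
Qed.
End IdealFacts.

Lemma idpow_is_ideal J m : is_ideal (idpow J m).
Proof. by case: m => [|m]; [split | apply: gen_is_ideal]. Qed.

Lemma idpowS J m a b : idpow J m a -> J b -> idpow J m.+1 (a * b).
Proof. by move=> Ja Jb; apply: gen_mem; exists a, b. Qed.

Lemma idpowM J m n a b :
  idpow J m a -> idpow J n b -> idpow J (m + n) (a * b).
Proof.
move=> Ja; elim: n b => [|n IH] b Jb.
  by rewrite addn0; apply: (idealMr (idpow_is_ideal J m)).
rewrite addnS; apply: (gen_min (J := fun b => idpow J (m + n).+1 (a * b))) Jb.
  split; first by rewrite mulr0; case: (idpow_is_ideal J (m + n).+1).
  split=> [u v|r u]; first by rewrite mulrDr; apply: (idealD (idpow_is_ideal _ _)).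
  by rewrite mulrCA; apply: (idealMl (idpow_is_ideal _ _)).
by move=> _ [c [d [Jc [Jd ->]]]]; rewrite mulrA; apply: idpowS => //; apply: IH.
Qed.

Lemma idpowX J m a n : idpow J m a -> idpow J (m * n) (a ^+ n).
Proof.
move=> Ja; elim: n => [|n IH]; first by rewrite muln0.
by rewrite mulnS exprS; apply: idpowM.
Qed.

Lemma idpow1 J a : J a -> idpow J 1 a.
Proof. by move=> Ja; rewrite -[a]mul1r; apply: (idpowS (m := 0)). Qed.

(** * The generators and the product of the 18 planes under permutations of the variables *)

Lemma ord4E (i : 'I_4) : [\/ i = 0, i = 1, i = 2 | i = 3].
Proof.
case: i => [[|[|[|[|//]]]] lti].
- by apply: Or41; apply: val_inj.
- by apply: Or42; apply: val_inj.
- by apply: Or43; apply: val_inj.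
- by apply: Or44; apply: val_inj.
Qed.

(** The three splittings of the four indices into two pairs give three such products. They are taken
    at a family in any commutative ring so that restrictions can be pushed through them. *)
Definition cub (S : comNzRingType) (v : 'I_4 -> S) (i j k l : 'I_4) : S :=
  (v i ^+ 3 - v j ^+ 3) * (v k ^+ 3 - v l ^+ 3).
(* At the coordinate functions, the product of all the x_p^3 - x_q^3, up to sign. *)
Definition arr (S : comNzRingType) (v : 'I_4 -> S) (i j k l : 'I_4) : S :=
  cub v i j k l * cub v i k j l * cub v i l j k.
Definition I3gen_at (S : comNzRingType) (v : 'I_4 -> S) : seq S :=
  [:: cub v 0 1 2 3 * v 0 * v 1; cub v 0 1 2 3 * v 2 * v 3;
      cub v 0 2 1 3 * v 0 * v 2; cub v 0 2 1 3 * v 1 * v 3;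
      cub v 0 3 1 2 * v 0 * v 3; cub v 0 3 1 2 * v 1 * v 2].
Definition X4 (i : 'I_4) : R4 := 'X_i.

Lemma I3gensE : I3gens = I3gen_at X4.
Proof. by []. Qed.

(** Permuting the indices permutes the six generators up to sign, so a line may be treated with its
    coordinates named i, j, k, l. *)
Lemma I3gen_at_mem (S : comNzRingType) (v : 'I_4 -> S) i j k l :
  uniq [:: i; j; k; l] ->
  exists2 n, (n < 6)%N & exists e : bool,
    cub v i j k l * v i * v j = (-1) ^+ e * nth 0 (I3gen_at v) n.
Proof.
case: (ord4E i) => ->; case: (ord4E j) => ->; case: (ord4E k) => ->;
  case: (ord4E l) => -> //= _; rewrite /I3gen_at /cub;
first [ by exists 0%N => //; exists false; rewrite /=; ring
 | by exists 0%N => //; exists true; rewrite /=; ring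
 | by exists 1%N => //; exists false; rewrite /=; ring
 | by exists 1%N => //; exists true; rewrite /=; ring
 | by exists 2%N => //; exists false; rewrite /=; ring
 | by exists 2%N => //; exists true; rewrite /=; ring
 | by exists 3%N => //; exists false; rewrite /=; ring
 | by exists 3%N => //; exists true; rewrite /=; ring
 | by exists 4%N => //; exists false; rewrite /=; ring
 | by exists 4%N => //; exists true; rewrite /=; ring
 | by exists 5%N => //; exists false; rewrite /=; ring
 | by exists 5%N => //; exists true; rewrite /=; ring ].
Qed.

Lemma I3_mem i j k l : uniq [:: i; j; k; l] -> I3 (cub X4 i j k l * X4 i * X4 j).
Proof.
move=> /(I3gen_at_mem X4)[n n6 [e ->]]; apply: (idealMl (gen_is_ideal _)).
by apply: gen_mem; rewrite I3gensE; apply: mem_nth.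
Qed.

(** Up to sign [arr] is the Vandermonde determinant of the four cubes, hence alternating. *)
Lemma arr_sym (S : comNzRingType) (v : 'I_4 -> S) i j k l :
  uniq [:: i; j; k; l] -> exists e : bool, arr v 0 1 2 3 = (-1) ^+ e * arr v i j k l.
Proof.
case: (ord4E i) => ->; case: (ord4E j) => ->; case: (ord4E k) => ->;
  case: (ord4E l) => -> //= _; rewrite /arr /cub;
first [ by exists false; ring | by exists true; ring ].
Qed.

(** * Order of vanishing along a line *)

Section Substitution.
Variable n : nat.

Lemma mpoly_alg_ind (K : nzRingType) (T : {mpoly K[n]} -> Prop) :
  (forall c, T c%:MP) -> (forall i, T 'X_i) ->
  (forall p q, T p -> T q -> T (p + q)) ->
  (forall p q, T p -> T q -> T (p * q)) -> forall p, T p.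
Proof.
move=> TC TX TD TM p; rewrite (mpolyE p).
elim: (msupp p) => [|m s IH]; first by rewrite big_nil -mpolyC0.
rewrite big_cons; apply: (TD) => //; rewrite -mul_mpolyC; apply: (TM) => //.
rewrite mpolyXE_id; elim: (index_enum _) => [|i r IHr].
  by rewrite big_nil -mpolyC1.
rewrite big_cons; apply: (TM) => //; elim: (m i) => [|d IHd].
  by rewrite expr0 -mpolyC1.
by rewrite exprS; apply: (TM).
Qed.

Variables (K S : comNzRingType).

Lemma rmorph_mpoly_eq (f g : {rmorphism {mpoly K[n]} -> S}) :
  (forall c, f c%:MP = g c%:MP) -> (forall i, f 'X_i = g 'X_i) -> f =1 g.
Proof.
move=> fgC fgX; apply: mpoly_alg_ind => // p q Ep Eq; first by rewrite !rmorphD Ep Eq.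
by rewrite !rmorphM Ep Eq.
Qed.

End Substitution.

(* For the line parametrised by [s], [psi s] is restriction to the line and [phi s]
   rescales the normal directions by ['X]: the order of vanishing of f along the line is
   the ['X]-adic valuation of [phi s f]. *)
Definition psi (s : 'I_4 -> R4) : {rmorphism R4 -> R4} := mmap (@mpolyC 4 CC) s.

Definition phi (s : 'I_4 -> R4) : {rmorphism R4 -> {poly R4}} :=
  mmap (@polyC R4 \o @mpolyC 4 CC) (fun m => (s m)%:P + 'X * (X4 m - s m)%:P).

Lemma psiX s i : psi s (X4 i) = s i. Proof. by rewrite /psi /X4 /= mmapX mmap1U. Qed.

Lemma psiC s c : psi s c%:MP = c%:MP. Proof. exact: mmapC. Qed.

Lemma psiM s p q : psi s (p * q) = psi s p * psi s q. Proof. exact: rmorphM. Qed.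
Lemma psiB s p q : psi s (p - q) = psi s p - psi s q. Proof. exact: rmorphB. Qed.
Lemma psiD s p q : psi s (p + q) = psi s p + psi s q. Proof. exact: rmorphD. Qed.
Lemma psiXn s p n : psi s (p ^+ n) = psi s p ^+ n. Proof. exact: rmorphXn. Qed.

Lemma phiX s i : phi s (X4 i) = (s i)%:P + 'X * (X4 i - s i)%:P.
Proof. by rewrite /phi /X4 /= mmapX mmap1U. Qed.

Lemma phiC s c : phi s c%:MP = (c%:MP)%:P. Proof. exact: mmapC. Qed.

Lemma phi_at0 s f : (phi s f).[0] = psi s f.
Proof.
apply: (rmorph_mpoly_eq (f := horner_eval 0 \o phi s)) => [c|i] /=.
  by rewrite phiC psiC /horner_eval hornerC.
by rewrite -/(X4 i) phiX psiX /horner_eval !hornerE.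
Qed.

Lemma phi_at1 s f : (phi s f).[1] = f.
Proof.
apply: (rmorph_mpoly_eq (f := horner_eval 1 \o phi s) (g := idfun)) => [c|i] /=.
  by rewrite phiC /horner_eval hornerC.
by rewrite -/(X4 i) phiX /horner_eval hornerD hornerM hornerX !hornerC mul1r addrC subrK.
Qed.

(** Modulo J each variable equals its image, hence so does each polynomial. This identifies the
    kernel of a restriction with the ideal of its linear equations. *)
Lemma sub_psi_mem (J : R4 -> Prop) s f :
  is_ideal J -> (forall m, J (X4 m - s m)) -> J (f - psi s f).
Proof.
move=> idJ Js; elim/(mpoly_alg_ind (n := 4) (K := CC)): f => [c|i|p q Jp Jq|p q Jp Jq].
- by rewrite psiC subrr; case: idJ.
- by rewrite -/(X4 i) psiX.
- by rewrite rmorphD opprD addrACA; exact: (idealD idJ Jp Jq).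
have -> : p * q - psi s (p * q) = (p - psi s p) * q + psi s p * (q - psi s q).
  by rewrite rmorphM; move: (psi s p) (psi s q) => u v; ring.
exact: (idealD idJ (idealMr idJ _ Jp) (idealMl idJ _ Jq)).
Qed.

(** One factor is removed at a time: evaluation at r shows that the remaining cofactor of f vanishes
    there, since p does not. *)
Lemma cancel_Xsub_exp (D : idomainType) (p f q : {poly D}) (r : D) k :
  p.[r] != 0 -> p * f = q * ('X - r%:P) ^+ k -> exists g, f = g * ('X - r%:P) ^+ k.
Proof.
move=> pr; elim: k q => [|k IH] q; first by exists f; rewrite mulr1.
rewrite exprS mulrA => E; case: (IH _ E) => g fE; move: E.
rewrite fE mulrA => /mulIf; rewrite expf_neq0 ?polyXsubC_eq0 // => /(_ isT) E.
have /factor_theorem[h gE] : root g r.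
  have := congr1 (fun p => p.[r]) E.
  by rewrite !hornerM hornerXsubC subrr mulr0 => /eqP; rewrite mulf_eq0 (negbTE pr).
by exists h; rewrite gE mulrA.
Qed.

Lemma cancel_X_exp (D : idomainType) (p f q : {poly D}) k :
  p.[0] != 0 -> p * f = q * 'X^k -> exists g, f = g * 'X^k.
Proof. by move=> p0; rewrite -['X]subr0 -polyC0 => /(cancel_Xsub_exp p0). Qed.

Definition ord_ge (s : 'I_4 -> R4) (k : nat) (f : R4) : Prop :=
  exists q, phi s f = q * 'X^k.

(** This absorbs the localisation in the symbolic power: a multiplier that is nonzero on the line
    has order 0. *)
Lemma ord_ge_cancel s k p f : psi s p != 0 -> ord_ge s k (p * f) -> ord_ge s k f.
Proof.
by rewrite -phi_at0 => p0 [q]; rewrite rmorphM => /(cancel_X_exp p0).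
Qed.

Lemma ord_ge_is_ideal s k : is_ideal (ord_ge s k).
Proof.
split; first by exists 0; rewrite rmorph0 mul0r.
split=> [a b [p Ep] [q Eq] | r a [p Ep]].
  by exists (p + q); rewrite rmorphD mulrDl Ep Eq.
by exists (phi s r * p); rewrite rmorphM -mulrA Ep.
Qed.

Lemma ord_ge1 s f : psi s f = 0 -> ord_ge s 1 f.
Proof.
move=> f0; have /factor_theorem[q Eq] : root (phi s f) 0 by rewrite /root phi_at0 f0.
by exists q; rewrite Eq subr0.
Qed.

Lemma ord_ge_idpow s (J : R4 -> Prop) k f :
  (forall g, J g -> psi s g = 0) -> idpow J k f -> ord_ge s k f.
Proof.
move=> J0; elim: k f => [|k IH] f; first by move=> _; exists (phi s f); rewrite mulr1.
apply: gen_min (ord_ge_is_ideal _ _) _ _ => _ [a [b [/IH[p Ep] [/J0/ord_ge1[q Eq] ->]]]].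
by exists (p * q); rewrite rmorphM /= Ep Eq expr1 mulrACA -exprSr.
Qed.

(** * Orders of vanishing under restriction *)

Section Rees.
Variables (A S : comNzRingType) (rho : {rmorphism A -> S}) (u : S).

(** The preimage under [rho] of the Rees algebra of the ideal (u). *)
Definition rees (p : {poly A}) : Prop := forall n, exists w, rho p`_n = w * u ^+ n.

Lemma reesC c : rees c%:P.
Proof.
move=> [|n]; rewrite coefC /=; first by exists (rho c); rewrite mulr1.
by exists 0; rewrite rmorph0 mul0r.
Qed.

Lemma reesX c : (exists w, rho c = w * u) -> rees ('X * c%:P).
Proof.
move=> [w Ew] [|[|n]]; rewrite coefXM coefC /=.
- by exists 0; rewrite rmorph0 mul0r.
- by exists w; rewrite Ew.
by exists 0; rewrite rmorph0 mul0r.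
Qed.

Lemma reesD p q : rees p -> rees q -> rees (p + q).
Proof.
move=> Jp Jq n; have [[v Ev] [w Ew]] := (Jp n, Jq n).
by exists (v + w); rewrite coefD rmorphD Ev Ew mulrDl.
Qed.

Lemma multiples_sum (T : Type) (r : seq T) (P : pred T) (F : T -> S) (d : S) :
  (forall i, P i -> exists w, F i = w * d) -> exists w, \sum_(i <- r | P i) F i = w * d.
Proof.
move=> dF; apply: (big_ind (fun x => exists w, x = w * d)) => //.
  by exists 0; rewrite mul0r.
by move=> x y [v ->] [w ->]; exists (v + w); rewrite mulrDl.
Qed.

Lemma reesM p q : rees p -> rees q -> rees (p * q).
Proof.
move=> Jp Jq n; rewrite coefM rmorph_sum; apply: multiples_sum => -[i /= lei] _.
have [[v Ev] [w Ew]] := (Jp i, Jq (n - i)%N).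
by exists (v * w); rewrite rmorphM Ev Ew mulrACA -exprD subnKC.
Qed.

(** At 1 the polynomial is the sum of its coefficients: those below k are zero and the others map to
    multiples of u^k. *)
Lemma rees_at1 p q k : rees p -> p = q * 'X^k -> exists w, rho p.[1] = w * u ^+ k.
Proof.
move=> Jp Eq; rewrite horner_coef rmorph_sum; apply: multiples_sum => -[i /= _] _.
rewrite expr1n mulr1; case: (ltnP i k) => [ltik|leki].
  have -> : p`_i = 0 by rewrite [in LHS]Eq coefMXn ltik.
  by exists 0; rewrite rmorph0 mul0r.
have [w ->] := Jp i; exists (w * u ^+ (i - k)).
by rewrite -mulrA -exprD subnK.
Qed.
End Rees.

Lemma rees_phi (S : comNzRingType) (rho : {rmorphism R4 -> S}) s (u : S) :
  (forall m, exists w, rho (X4 m - s m) = w * u) -> forall f, rees rho u (phi s f).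
Proof.
move=> rs; apply: (@mpoly_alg_ind 4 CC) => [c|i|p q Jp Jq|p q Jp Jq].
- by rewrite phiC; exact: reesC.
- by rewrite -/(X4 i) phiX; exact: reesD (reesC _ _ _) (reesX (rs i)).
- by rewrite rmorphD; exact: reesD.
by rewrite rmorphM; exact: reesM.
Qed.

(** Since [phi s f] has value f at 1, order of vanishing along a line becomes multiplicity along u
    wherever the equations of the line become multiples of u. *)
Lemma ord_ge_restrict (S : comNzRingType) (rho : {rmorphism R4 -> S}) s (u : S) k f :
  (forall m, exists w, rho (X4 m - s m) = w * u) ->
  ord_ge s k f -> exists w, rho f = w * u ^+ k.
Proof.
move=> rs [q Eq]; have [w Ew] := rees_at1 (rees_phi rs f) Eq.
by exists w; rewrite -Ew phi_at1.
Qed.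

(** * The 42 lines *)

Definition lsub (i j k : 'I_4) (a b : CC) (m : 'I_4) : R4 :=
  if m == i then a%:MP * X4 k else if m == j then b%:MP * X4 k else X4 m.

(* The line x_i = a x_k, x_j = b x_k; for a = b = 0 it is the coordinate line
   x_i = x_j = 0 and the choice of k is immaterial. *)
Definition is_line (i j k l : 'I_4) (a b : CC) : Prop :=
  uniq [:: i; j; k; l] /\ (a = 0 /\ b = 0 \/ a ^+ 3 = 1 /\ b ^+ 3 = 1).

Lemma lsub_at i j k l a b : uniq [:: i; j; k; l] ->
  [/\ lsub i j k a b i = a%:MP * X4 k, lsub i j k a b j = b%:MP * X4 k,
      lsub i j k a b k = X4 k & lsub i j k a b l = X4 l].
Proof.
rewrite /= !inE !negb_or -!andbA => /and4P[ij ik il /and4P[jk jl kl _]].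
rewrite /lsub !eqxx [j == i]eq_sym [k == i]eq_sym [l == i]eq_sym [k == j]eq_sym.
by rewrite [l == j]eq_sym (negbTE ij) (negbTE ik) (negbTE il) (negbTE jk) (negbTE jl).
Qed.

Lemma lsub_gen_mem (J : R4 -> Prop) i j k a b :
  is_ideal J -> J (X4 i - a%:MP * X4 k) -> J (X4 j - b%:MP * X4 k) ->
  forall m, J (X4 m - lsub i j k a b m).
Proof.
move=> idJ Ji Jj m; rewrite /lsub; case: eqP => [->|_]; first exact: Ji.
case: eqP => [->|_]; first exact: Jj.
by rewrite subrr; case: idJ.
Qed.

Lemma rmorph_I3gen_at (A B : comNzRingType) (f : {rmorphism A -> B}) (v : 'I_4 -> A) :
  [seq f g | g <- I3gen_at v] = I3gen_at (f \o v).
Proof. by rewrite /I3gen_at /cub /= !(rmorphXn, rmorphM, rmorphB). Qed.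

(** Each generator pairs up the four indices. If three cubes agree, two of the three indices form a
    pair and a cube difference vanishes. If v_i = v_j = 0, either i and j form a pair, or each pair
    contains one of them and the monomial factor vanishes. *)
Lemma I3gen_at_eq0 (S : comNzRingType) (v : 'I_4 -> S) i j k :
  uniq [:: i; j; k] ->
  v i = 0 /\ v j = 0 \/ v i ^+ 3 = v k ^+ 3 /\ v j ^+ 3 = v k ^+ 3 ->
  forall g, g \in I3gen_at v -> g = 0.
Proof.
move=> ijk H g; rewrite !inE /cub => gI; case: H => [][Hi Hj]; move: ijk Hi Hj gI.
  case: (ord4E i) => ->; case: (ord4E j) => ->; case: (ord4E k) => -> //= _ -> ->;
  rewrite ?expr0n /= ?(subr0, sub0r, subrr, mulr0, mul0r, mulrN) ?orbb;
  by do ?case/orP; move/eqP.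
case: (ord4E i) => ->; case: (ord4E j) => ->; case: (ord4E k) => -> //= _ -> ->;
rewrite ?(subrr, mulr0, mul0r) ?orbb;
by do ?case/orP; move/eqP.
Qed.

Lemma cubeB (S : comNzRingType) (c x y : S) : c ^+ 3 = 1 ->
  x ^+ 3 - y ^+ 3 = (x - c * y) * (x ^+ 2 + c * x * y + c ^+ 2 * y ^+ 2).
Proof. by move=> c3; rewrite -[y ^+ 3]mul1r -c3; ring. Qed.

Lemma cube_root_neq0 (A : idomainType) (c : A) : c ^+ 3 = 1 -> c != 0.
Proof. by move=> c3; apply/eqP => c0; move/eqP: c3; rewrite c0 expr0n eq_sym oner_eq0. Qed.

Lemma mpolyC_cube (c : CC) : c ^+ 3 = 1 -> (c%:MP : R4) ^+ 3 = 1.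
Proof. by move=> c3; rewrite -rmorphXn c3. Qed.

Lemma CC_natr_neq0 n : (n.+1%:R : CC) != 0.
Proof.
have : (n.+1%:R : complex Rdefinitions.R) != 0 by rewrite Num.Theory.pnatr_eq0.
exact.
Qed.

Lemma X4_neq0 i : X4 i != 0.
Proof. by apply/eqP => /(congr1 (mcoeff U_(i))); rewrite mcoeffXU eqxx mcoeff0; apply/eqP/oner_neq0. Qed.

Lemma X4_cubeB_neq0 k l : k != l -> X4 k ^+ 3 - X4 l ^+ 3 != 0.
Proof.
move=> kl; apply/eqP => /(congr1 (meval (fun m => (m == k)%:R))).
rewrite rmorphB rmorphXn rmorphXn /= !mevalXU eqxx eq_sym (negbTE kl) expr1n expr0n subr0.
by rewrite meval0; apply/eqP/oner_neq0.
Qed.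

Lemma mpolyC_natr_neq0 n : (n.+1%:R : R4) != 0.
Proof. by rewrite -mpolyC_nat mpolyC_eq0 CC_natr_neq0. Qed.

Lemma uniq4_perms (i j k l : 'I_4) : uniq [:: i; j; k; l] ->
  [/\ uniq [:: i; k; j; l], uniq [:: j; l; i; k] & uniq [:: j; k; i; l]].
Proof.
by case: (ord4E i) => ->; case: (ord4E j) => ->; case: (ord4E k) => ->;
  case: (ord4E l) => ->.
Qed.

(** * One line, with an abstract domain in place of the polynomial ring *)

Section GenericLine.
Variables (A : idomainType) (x : 'I_4 -> A) (f : {rmorphism A -> A}).
Variables (i j k l : 'I_4) (al be : A).
Hypothesis ijkl : uniq [:: i; j; k; l].
Hypotheses (fi : f (x i) = al * x k) (fj : f (x j) = be * x k).
Hypotheses (fk : f (x k) = x k) (fl : f (x l) = x l).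
Hypotheses (fal : f al = al) (fbe : f be = be).
Hypothesis albe : al = 0 /\ be = 0 \/ al ^+ 3 = 1 /\ be ^+ 3 = 1.
Hypotheses (x0 : forall m, x m != 0) (xB0 : forall m n, m != n -> x m ^+ 3 - x n ^+ 3 != 0).
Hypothesis three0 : 3%:R != 0 :> A.

(** The cofactor of x - cy in x^3 - y^3 equals 3c^2y^2 at x = cy. *)
Lemma quad_neq0 (c y : A) : c ^+ 3 = 1 -> y != 0 ->
  (c * y) ^+ 2 + c * (c * y) * y + c ^+ 2 * y ^+ 2 != 0.
Proof.
move=> c3 y0; have c0 := cube_root_neq0 c3.
have -> : (c * y) ^+ 2 + c * (c * y) * y + c ^+ 2 * y ^+ 2 = 3%:R * (c ^+ 2 * y ^+ 2) by ring.
by rewrite !mulf_neq0 ?expf_neq0.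
Qed.

Let neqs : [/\ i != j, i != k, j != k & k != l].
Proof. by move: ijkl; rewrite /= !inE !negb_or -!andbA => /and4P[-> -> _ /and4P[-> _ -> _]]. Qed.

Section Witness.
Variables I J : A -> Prop.
Hypotheses (IB : forall u v, I u -> I v -> I (u - v)) (IM : forall r u, I u -> I (r * u)).
Hypotheses (JB : forall u v, J u -> J v -> J (u - v)) (JM : forall r u, J u -> J (r * u)).
Hypothesis IJ : forall u v w, I u -> I v -> I w -> J (u * v * w).
Hypothesis Igen : forall i j k l, uniq [:: i; j; k; l] -> I (cub x i j k l * x i * x j).

(** I stands for [I3] and J for its third power. The last clause says that [arr] lies in J locally
    at the line. *)
Lemma line_witness_generic : exists g : A,
  [/\ f g != 0, I ((x i - al * x k) * g), I ((x j - be * x k) * g)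
    & J (g ^+ 3 * arr x i j k l)].
Proof.
have [ikjl jlik jkil] := uniq4_perms ijkl; have [_ _ _ kl] := neqs.
case: albe => [][Ha Hb].
  (* Chosen so that x_i g and x_j g are both multiples of generators. *)
  pose g := x k * x l * cub x i k j l; exists g.
  have Ii : I (x i * g).
    have -> : x i * g = x l * (cub x i k j l * x i * x k) by rewrite /g; ring.
    by apply: IM; apply: Igen.
  have Ij : I (x j * g).
    have -> : x j * g = x k * (cub x j l i k * x j * x l) by rewrite /g /cub; ring.
    by apply: IM; apply: Igen.
  split.
  - rewrite /g /cub !(rmorphXn, rmorphM, rmorphB) fi fj fk fl Ha Hb !mul0r expr0n !sub0r.
    by rewrite !mulf_neq0 ?oppr_eq0 ?expf_neq0.
  - by rewrite Ha mul0r subr0.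
  - by rewrite Hb mul0r subr0.
  (* The factor of [arr] vanishing on the line is x_i^3 - x_j^3, and g^3 turns it into a difference
     of cubes of elements of I. *)
  have -> : g ^+ 3 * arr x i j k l = (x k ^+ 3 - x l ^+ 3) * cub x i k j l * cub x i l j k *
      (x i * g * (x i * g) * (x i * g) - x j * g * (x j * g) * (x j * g)).
    by rewrite /arr /cub; ring.
  by apply: JM; apply: JB; apply: IJ.
(* [ga] and [gb] are generators divided by the two equations of the line. *)
pose qa := x i ^+ 2 + al * x i * x k + al ^+ 2 * x k ^+ 2.
pose qb := x j ^+ 2 + be * x j * x k + be ^+ 2 * x k ^+ 2.
pose ga := qa * (x j ^+ 3 - x l ^+ 3) * x i * x k.
pose gb := qb * (x i ^+ 3 - x l ^+ 3) * x j * x k.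
exists (ga * gb).
have Ei : (x i - al * x k) * ga = cub x i k j l * x i * x k.
  by rewrite /cub (cubeB _ _ Ha) /ga -/qa; ring.
have Ej : (x j - be * x k) * gb = cub x j k i l * x j * x k.
  by rewrite /cub (cubeB _ _ Hb) /gb -/qb; ring.
have Ii : I ((x i - al * x k) * (ga * gb)).
  by rewrite mulrA Ei mulrC; apply: IM; apply: Igen.
have Ij : I ((x j - be * x k) * (ga * gb)).
  by rewrite mulrCA Ej; apply: IM; apply: Igen.
split=> //.
- rewrite /ga /gb /qa /qb !(rmorphXn, rmorphM, rmorphB, rmorphD) fi fj fk fl fal fbe.
  have [al0 be0] := (cube_root_neq0 Ha, cube_root_neq0 Hb).
  have cubeM (c : A) : c ^+ 3 = 1 -> (c * x k) ^+ 3 = x k ^+ 3.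
    by move=> c3; rewrite exprMn c3 mul1r.
  by rewrite !cubeM // !mulf_neq0 ?quad_neq0 ?xB0.
have Ik : I ((x i ^+ 3 - x k ^+ 3) * (ga * gb)).
  by rewrite (cubeB _ _ Ha) mulrAC mulrC; apply: IM.
have Jk : I ((x j ^+ 3 - x k ^+ 3) * (ga * gb)).
  by rewrite (cubeB _ _ Hb) mulrAC mulrC; apply: IM.
(* Three factors of [arr] vanish on the line. One, x_i^3 - x_j^3, is the difference of the other
   two, so each of them times [ga * gb] lies in I. *)
have -> : (ga * gb) ^+ 3 * arr x i j k l =
    ((x k ^+ 3 - x l ^+ 3) * (x j ^+ 3 - x l ^+ 3) * (x i ^+ 3 - x l ^+ 3)) *
    ((x i ^+ 3 - x k ^+ 3) * (ga * gb) * ((x j ^+ 3 - x k ^+ 3) * (ga * gb)) *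
    ((x i ^+ 3 - x k ^+ 3) * (ga * gb) - (x j ^+ 3 - x k ^+ 3) * (ga * gb))).
  by rewrite /arr /cub; move: (ga * gb) => g; ring.
by apply: JM; apply: IJ => //; apply: IB.
Qed.
End Witness.

(** The order is exactly 3: a coordinate line lies in the three planes of x_i^3 = x_j^3, and any
    other line lies in one plane from each of the three cube differences in x_i, x_j, x_k. *)
Lemma arr_order_generic (F : {rmorphism A -> {poly A}}) :
  (forall p, (F p).[0] = f p) -> F al = al%:P -> F be = be%:P ->
  (forall m, F (x m) = (f (x m))%:P + 'X * (x m - f (x m))%:P) ->
  exists G, F (arr x i j k l) = 'X^3 * G /\ G.[0] != 0.
Proof.
move=> F0 Fa Fb Fx; have [ij ik jk kl] := neqs.
have arrE : arr x i j k l = (x i ^+ 3 - x j ^+ 3) * (x i ^+ 3 - x k ^+ 3) *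
   (x j ^+ 3 - x k ^+ 3) * ((x k ^+ 3 - x l ^+ 3) * (x j ^+ 3 - x l ^+ 3) *
   (x i ^+ 3 - x l ^+ 3)) by rewrite /arr /cub; ring.
case: albe => [][Ha Hb].
  have Fi : F (x i) = 'X * (x i)%:P by rewrite Fx fi Ha mul0r add0r subr0.
  have Fj : F (x j) = 'X * (x j)%:P by rewrite Fx fj Hb mul0r add0r subr0.
  pose rest := (x i ^+ 3 - x k ^+ 3) * (x j ^+ 3 - x k ^+ 3) *
    ((x k ^+ 3 - x l ^+ 3) * (x j ^+ 3 - x l ^+ 3) * (x i ^+ 3 - x l ^+ 3)).
  exists ((x i ^+ 3 - x j ^+ 3)%:P * F rest); split.
    have -> : arr x i j k l = (x i ^+ 3 - x j ^+ 3) * rest by rewrite arrE /rest; ring.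
    rewrite rmorphM mulrA; congr (_ * _).
    by rewrite !rmorphB !rmorphXn Fi Fj !exprMn mulrBr.
  rewrite hornerM hornerC F0 /rest !(rmorphXn, rmorphM, rmorphB) fi fj fk fl Ha Hb.
  by rewrite !mul0r expr0n !sub0r !mulf_neq0 ?oppr_eq0 ?expf_neq0 ?xB0.
(* [F] multiplies by ['X] a linear form that vanishes on the line. *)
have Flin (m n : 'I_4) (c : A) : c ^+ 3 = 1 -> F c = c%:P -> f (x m) = c * f (x n) ->
  F (x m ^+ 3 - x n ^+ 3) = 'X * ((x m - c * x n)%:P *
    F (x m ^+ 2 + c * x m * x n + c ^+ 2 * x n ^+ 2)).
  move=> c3 Fc fm; rewrite (cubeB _ _ c3) rmorphM mulrA; congr (_ * _).
  rewrite rmorphB rmorphM /= Fc !Fx fm !rmorphB !rmorphM /=.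
  by move: (x m)%:P (x n)%:P (f (x n))%:P c%:P => u v w d; ring.
(* On the line x_i is al/be times x_j, and the inverse of [be] is its square. *)
have ab3 : (al * be ^+ 2) ^+ 3 = 1.
  by rewrite exprMn Ha -exprM mulnC exprM Hb expr1n mulr1.
have Fab : F (al * be ^+ 2) = (al * be ^+ 2)%:P.
  by rewrite rmorphM rmorphXn /= Fa Fb -rmorphXn -rmorphM.
have Ei := Flin i k al Ha Fa (etrans fi (congr1 _ (esym fk))).
have Ej := Flin j k be Hb Fb (etrans fj (congr1 _ (esym fk))).
have fij : f (x i) = al * be ^+ 2 * f (x j) by rewrite fi fj -[LHS]mul1r -Hb; ring.
have Eij := Flin i j _ ab3 Fab fij.
have lin0 (m n : 'I_4) (c : A) : c ^+ 3 = 1 -> m != n -> x m - c * x n != 0.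
  move=> c3 mn; apply/eqP => c0; have /eqP := xB0 mn.
  by rewrite (cubeB _ _ c3) c0 mul0r.
have quad0 (m n : 'I_4) (c : A) : c ^+ 3 = 1 -> f c = c -> f (x m) = c * f (x n) ->
    f (x n) != 0 -> f (x m ^+ 2 + c * x m * x n + c ^+ 2 * x n ^+ 2) != 0.
  by move=> c3 fc fm fn; rewrite !(rmorphXn, rmorphM, rmorphD) fc fm quad_neq0.
set P1 := _%:P * F _ in Eij; set P2 := _%:P * F _ in Ei; set P3 := _%:P * F _ in Ej.
pose rest := (x k ^+ 3 - x l ^+ 3) * (x j ^+ 3 - x l ^+ 3) * (x i ^+ 3 - x l ^+ 3).
exists (P1 * P2 * P3 * F rest); split.
  by rewrite arrE -/rest 3!rmorphM Eij Ei Ej; move: (F rest) (P1) (P2) (P3) => z z1 z2 z3; ring.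
have fj0 : f (x j) != 0 by rewrite fj mulf_neq0 ?(cube_root_neq0 Hb).
have fk0 : f (x k) != 0 by rewrite fk.
have fab : f (al * be ^+ 2) = al * be ^+ 2 by rewrite rmorphM rmorphXn fal fbe.
have fik : f (x i) = al * f (x k) by rewrite fi fk.
have fjk : f (x j) = be * f (x k) by rewrite fj fk.
rewrite !hornerM !hornerC !F0 !mulf_neq0 ?lin0 ?quad0 //.
rewrite /rest !(rmorphXn, rmorphM, rmorphB) fi fj fk fl !exprMn Ha Hb !mul1r.
by rewrite !mulf_neq0 ?xB0.
Qed.
End GenericLine.

(** * The prime of a line and the order of symbolic powers along it *)

Section Line.
Variables (i j k l : 'I_4) (a b : CC).
Hypothesis lineL : is_line i j k l a b.
Let s := lsub i j k a b.

Let psi_at : [/\ psi s (X4 i) = a%:MP * X4 k, psi s (X4 j) = b%:MP * X4 k,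
  psi s (X4 k) = X4 k & psi s (X4 l) = X4 l].
Proof. by have [Ei Ej Ek El] := lsub_at a b (proj1 lineL); rewrite !psiX. Qed.

Let ab_cases : a%:MP = 0 :> R4 /\ b%:MP = 0 :> R4 \/
  (a%:MP : R4) ^+ 3 = 1 /\ (b%:MP : R4) ^+ 3 = 1.
Proof.
case: (proj2 lineL) => [][Ha Hb]; [left | right].
  by rewrite Ha Hb mpolyC0.
by split; apply: mpolyC_cube.
Qed.

Lemma psi_is_ideal : is_ideal (fun f => psi s f = 0).
Proof.
split; first exact: rmorph0.
split=> [u v u0 v0 | r u u0]; first by rewrite psiD u0 v0 addr0.
by rewrite psiM u0 mulr0.
Qed.

Lemma I3_sub_line f : I3 f -> psi s f = 0.
Proof.
apply: (gen_min psi_is_ideal) => g; rewrite I3gensE => gI.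
have ijk : uniq [:: i; j; k].
  by have := proj1 lineL; rewrite -[[:: i; j; k; l]]/([:: i; j; k] ++ [:: l]) cat_uniq => /and3P[].
apply: (I3gen_at_eq0 (v := psi s \o X4) ijk); last first.
  by rewrite -rmorph_I3gen_at; apply: map_f.
have [Ei Ej Ek _] := psi_at; rewrite /comp Ei Ej Ek.
case: ab_cases => [][Ha Hb]; [left | right].
  by rewrite Ha Hb mul0r.
by rewrite 2!exprMn Ha Hb mul1r.
Qed.

(* By the first three clauses the prime of the line is the annihilator of g in R/I3. *)
Lemma line_witness : exists g : R4,
  [/\ psi s g != 0, I3 ((X4 i - a%:MP * X4 k) * g),
      I3 ((X4 j - b%:MP * X4 k) * g) & idpow I3 3 (g ^+ 3 * arr X4 i j k l)].
Proof.
have [Ei Ej Ek El] := psi_at.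
have idI3 : is_ideal I3 := gen_is_ideal _.
have idJ := idpow_is_ideal I3 3.
apply: (line_witness_generic (proj1 lineL) Ei Ej Ek El (psiC s a) (psiC s b) ab_cases
  X4_neq0 X4_cubeB_neq0 (mpolyC_natr_neq0 2) (idealB idI3) (idealMl idI3) (idealB idJ) (idealMl idJ)).
  by move=> u v w Iu Iv Iw; apply: idpowS Iw; apply: idpowS Iv; exact: idpow1.
exact: I3_mem.
Qed.

Lemma line_arr_order : exists G, phi s (arr X4 i j k l) = 'X^3 * G /\ G.[0] != 0.
Proof.
have [Ei Ej Ek El] := psi_at.
apply: (arr_order_generic (proj1 lineL) Ei Ej Ek El (psiC s a) (psiC s b) ab_cases
  X4_neq0 X4_cubeB_neq0 (mpolyC_natr_neq0 2) (phi_at0 s) (phiC s a) (phiC s b)).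
by move=> m; rewrite phiX psiX.
Qed.

Lemma line_ideal f : psi s f = 0 ->
  exists p q, f = p * (X4 i - a%:MP * X4 k) + q * (X4 j - b%:MP * X4 k).
Proof.
move=> f0; rewrite -[f]subr0 -f0.
pose J (h : R4) := exists p q, h = p * (X4 i - a%:MP * X4 k) + q * (X4 j - b%:MP * X4 k).
have idJ : is_ideal J.
  split; first by exists 0, 0; rewrite !mul0r addr0.
  split=> [_ _ [p [q ->]] [p' [q' ->]] | r _ [p [q ->]]].
    by exists (p + p'), (q + q'); rewrite !mulrDl addrACA.
  by exists (r * p), (r * q); rewrite mulrDr !mulrA.
apply: (sub_psi_mem f idJ); apply: lsub_gen_mem => //.
  by exists 1, 0; rewrite mul1r mul0r addr0.
by exists 0, 1; rewrite mul1r mul0r add0r.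
Qed.

Lemma line_assoc_prime : assoc_prime I3 (fun f => psi s f = 0).
Proof.
split.
  split; first exact: psi_is_ideal.
  split; first by rewrite rmorph1; apply/eqP/oner_neq0.
  by move=> u v /eqP; rewrite psiM mulf_eq0 => /orP[]/eqP; [left | right].
have idI3 : is_ideal I3 := gen_is_ideal _.
have [g [g0 Ii Ij _]] := line_witness; exists g => h; split.
  move=> /line_ideal[p [q ->]]; rewrite mulrDl -!mulrA.
  exact: (idealD idI3 (idealMl idI3 _ Ii) (idealMl idI3 _ Ij)).
move=> /I3_sub_line; rewrite psiM => /eqP.
by rewrite mulf_eq0 => /orP[/eqP h0 | /(negP g0)[]]; exact: h0.
Qed.

Lemma symb_pow_ord n f : symb_pow I3 n f -> ord_ge s n f.
Proof.
move/(_ _ line_assoc_prime) => [t [/eqP t0 It]].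
exact: (ord_ge_cancel t0 (ord_ge_idpow I3_sub_line It)).
Qed.
End Line.

(** * Cube roots of unity and roots with multiplicity *)

Lemma cube_factor (A : comNzRingType) (w x y : A) : w ^+ 2 + w + 1 = 0 ->
  x ^+ 3 - y ^+ 3 = (x - 1 * y) * ((x - w * y) * (x - w ^+ 2 * y)).
Proof.
move=> w0; have w2 : w ^+ 2 = - w - 1.
  by apply/eqP; rewrite -subr_eq0 -w0; apply/eqP; ring.
have w3 : w ^+ 3 = 1 by rewrite exprS w2 mulrBr mulrN -expr2 w2; ring.
have -> : (x - w * y) * (x - w ^+ 2 * y) =
   x ^+ 2 - (w ^+ 2 + w) * x * y + w ^+ 3 * y ^+ 2 by ring.
by rewrite w3 w2; ring.
Qed.

Lemma cube_roots : exists rs : seq CC, [/\ uniq rs, size rs = 3,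
  forall c, c \in rs -> c ^+ 3 = 1 &
  forall x y : R4, x ^+ 3 - y ^+ 3 = \prod_(c <- rs) (x - c%:MP * y)].
Proof.
(* A primitive cube root of unity, as a solution of w^2 = -1 - w. *)
have [w Ew] := @GRing.solve_monicpoly CC 2 (fun=> -1) isT.
have w0 : w ^+ 2 + w + 1 = 0.
  by rewrite Ew !big_ord_recl big_ord0; ring.
have w2 : w ^+ 2 = - w - 1.
  by apply/eqP; rewrite -subr_eq0 -w0; apply/eqP; ring.
have w3 : w ^+ 3 = 1 by rewrite exprS w2 mulrBr mulrN -expr2 w2; ring.
have w_neq0 : w != 0 by apply/eqP => E; move/eqP: w0; rewrite E expr0n !add0r oner_eq0.
have w_neq1 : w != 1.
  apply/eqP => E; move/eqP: w0; rewrite E expr1n; apply/negP.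
  have -> : 1 + 1 + 1 = 3%:R :> CC by ring.
  exact: CC_natr_neq0.
exists [:: 1; w; w ^+ 2]; split=> //.
- rewrite /= !inE !negb_or eq_sym w_neq1 /= andbT; apply/andP; split.
    apply/eqP => E; move: w_neq1; rewrite -w3 exprS -E mulr1 eqxx //.
  by apply/eqP => E; move: w_neq1; rewrite -(mulfK w_neq0 w) -expr2 -E mulfV ?eqxx.
- move=> c; rewrite !inE => /or3P[] /eqP->; first exact: expr1n.
    exact: w3.
  by rewrite -exprM mulnC exprM w3 expr1n.
move=> x y; rewrite !big_cons big_nil mulr1 rmorphXn mpolyC1.
apply: cube_factor; move: (congr1 (@mpolyC 4 CC) w0).
by rewrite rmorphD rmorphD rmorphXn rmorph1 rmorph0.
Qed.

(** The powers of X - r are split off root by root, the powers already split off being nonzero at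
    the next root. The inequality is strict because [size] is the degree plus one. *)
Lemma size_gt_multiplicities (D : idomainType) (p : {poly D}) (rs : seq D) n :
  p != 0 -> uniq rs ->
  (forall r, r \in rs -> exists w, p = w * ('X - r%:P) ^+ n) ->
  (n * size rs < size p)%N.
Proof.
move=> p0 urs Hrs.
have [q Eq] : exists q, p = q * \prod_(r <- rs) ('X - r%:P) ^+ n.
  elim: rs urs Hrs => [|r rs IH] /=; first by exists p; rewrite big_nil mulr1.
  move=> /andP[rrs urs] Hrs.
  have [q Eq] : exists q, p = q * \prod_(r <- rs) ('X - r%:P) ^+ n.
    by apply: IH => // t trs; apply: Hrs; rewrite inE trs orbT.
  have [w Ew] := Hrs r (mem_head r rs).
  have P0 : (\prod_(r <- rs) ('X - r%:P) ^+ n).[r] != 0.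
    rewrite horner_prod prodf_seq_neq0; apply/allP => t trs /=.
    rewrite horner_exp hornerXsubC expf_neq0 // subr_eq0.
    by apply: contraNneq rrs => ->.
  have EP : \prod_(r <- rs) ('X - r%:P) ^+ n * q = w * ('X - r%:P) ^+ n.
    by rewrite mulrC -Eq.
  have [w' Ew'] := cancel_Xsub_exp P0 EP.
  by exists w'; rewrite big_cons mulrA -Ew'.
have q0 : q != 0 by apply: contraNneq p0 => q0; rewrite Eq q0 mul0r.
rewrite Eq size_Mmonic ?monic_prod // => [|r _]; last first.
  by rewrite monic_exp ?monicXsubC.
have -> : size (\prod_(r <- rs) ('X - r%:P) ^+ n) = (n * size rs).+1.
  elim: (rs) => [|r s IH]; first by rewrite big_nil muln0 size_poly1.
  rewrite big_cons size_Mmonic ?IH ?monic_prod //.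
  - by rewrite size_exp_XsubC addSn /= mulnS addnS.
  - by rewrite expf_neq0 ?polyXsubC_eq0.
  by move=> t _; rewrite monic_exp ?monicXsubC.
by rewrite addnS /= -[X in (X < _)%N]add0n ltn_add2r lt0n size_poly_eq0.
Qed.

Lemma big_ord4_perm (T : Type) (idx : T) (op : Monoid.com_law idx) (F : 'I_4 -> T) i j k l :
  uniq [:: i; j; k; l] ->
  \big[op/idx]_(q < 4) F q = \big[op/idx]_(q <- [:: i; j; k; l]) F q.
Proof.
move=> ijkl; rewrite [RHS]big_uniq //; apply: eq_bigl => q; apply/esym; move: ijkl.
by case: (ord4E i) => ->; case: (ord4E j) => ->; case: (ord4E k) => ->;
  case: (ord4E l) => ->; case: (ord4E q) => ->.
Qed.

Lemma uniq4_blocks (i j k l : 'I_4) : uniq [:: i; j; k; l] ->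
  uniq [:: i; j; l; k] /\ uniq [:: k; l; i; j].
Proof.
by case: (ord4E i) => ->; case: (ord4E j) => ->; case: (ord4E k) => ->;
  case: (ord4E l) => ->.
Qed.

(** * The lower bound *)

Definition rsub (i j : 'I_4) (a : CC) (m : 'I_4) : {poly R4} :=
  if m == i then (a%:MP)%:P * 'X else if m == j then 'X else (X4 m)%:P.

(* Restriction to the plane x_i = a x_j, as a polynomial in x_j over R4. *)
Definition rho (i j : 'I_4) (a : CC) : {rmorphism R4 -> {poly R4}} :=
  mmap (@polyC R4 \o @mpolyC 4 CC) (rsub i j a).

(** Restriction to the same plane with values in [R4], suited to divisibility; [rho] is suited to
    counting roots. *)
Definition hsub (i j : 'I_4) (a : CC) (m : 'I_4) : R4 :=
  if m == i then a%:MP * X4 j else X4 m.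

Lemma rhoX i j a m : rho i j a (X4 m) = rsub i j a m.
Proof. by rewrite /rho /X4 /= mmapX mmap1U. Qed.

Lemma rhoC i j a c : rho i j a c%:MP = (c%:MP)%:P. Proof. exact: mmapC. Qed.

Lemma rhoB i j a p q : rho i j a (p - q) = rho i j a p - rho i j a q.
Proof. exact: rmorphB. Qed.

Lemma rhoM i j a p q : rho i j a (p * q) = rho i j a p * rho i j a q.
Proof. exact: rmorphM. Qed.

Lemma rho_at i j a f : (rho i j a f).[X4 j] = psi (hsub i j a) f.
Proof.
apply: (rmorph_mpoly_eq (f := horner_eval (X4 j) \o rho i j a)) => [c|m] /=.
  by rewrite rhoC psiC /horner_eval hornerC.
rewrite -/(X4 m) rhoX psiX /horner_eval /rsub /hsub.
case: (m == i); first by rewrite hornerM hornerC hornerX.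
by case: eqP => [->|_]; rewrite ?hornerX ?hornerC.
Qed.

(** * The degree of the restriction to a plane *)

Section Degree.
Variables (i j k l : 'I_4) (a : CC).
Hypothesis ijkl : uniq [:: i; j; k; l].

Lemma rsub_at : [/\ rsub i j a i = (a%:MP)%:P * 'X, rsub i j a j = 'X,
  rsub i j a k = (X4 k)%:P & rsub i j a l = (X4 l)%:P].
Proof.
move: ijkl; rewrite /= !inE !negb_or -!andbA => /and4P[ij ik il /and4P[jk jl kl _]].
rewrite /rsub !eqxx [j == i]eq_sym [k == i]eq_sym [l == i]eq_sym [k == j]eq_sym.
by rewrite [l == j]eq_sym (negbTE ij) (negbTE ik) (negbTE il) (negbTE jk) (negbTE jl).
Qed.

Let s := lsub k l i 0 0.

Let klij : uniq [:: k; l; i; j] := proj2 (uniq4_blocks ijkl).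

Lemma monomial_ord4 (S : comNzRingType) (c : {rmorphism CC -> S}) (v : 'I_4 -> S) p q r t m :
  uniq [:: p; q; r; t] ->
  mmap c v 'X_[m] = v p ^+ m p * v q ^+ m q * v r ^+ m r * v t ^+ m t.
Proof.
move=> pqrt; rewrite mmapX /mmap1 (big_ord4_perm _ _ pqrt) !big_cons big_nil /=.
by rewrite mulr1 !mulrA.
Qed.

Lemma phi_monomial m : phi s 'X_[m] = 'X^(m k + m l) * ('X_[m])%:P.
Proof.
have [Ek El Ei Ej] := lsub_at 0 0 klij.
have Em : 'X_[m] = X4 k ^+ m k * X4 l ^+ m l * X4 i ^+ m i * X4 j ^+ m j.
  by rewrite -[LHS]comp_mpoly_id /comp_mpoly (monomial_ord4 _ _ _ klij) !tnth_mktuple.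
have P0 q : s q = 0 -> phi s (X4 q) = 'X * (X4 q)%:P.
  by move=> sq; rewrite phiX sq add0r subr0.
have {P0} [Pk Pl] : phi s (X4 k) = 'X * (X4 k)%:P /\ phi s (X4 l) = 'X * (X4 l)%:P.
  by split; apply: P0; rewrite /s ?Ek ?El mpolyC0 mul0r.
have P1 q : s q = X4 q -> phi s (X4 q) = (X4 q)%:P.
  by move=> sq; rewrite phiX sq subrr mulr0 addr0.
have {P1} [Pi Pj] : phi s (X4 i) = (X4 i)%:P /\ phi s (X4 j) = (X4 j)%:P.
  by split; apply: P1.
rewrite Em 3!rmorphM 4!rmorphXn Pk Pl Pi Pj 3!polyCM 4!polyC_exp.
move: (X4 k)%:P (X4 l)%:P (X4 i)%:P (X4 j)%:P => x y z t.
by rewrite exprD !exprMn; ring.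
Qed.

(** Along the coordinate line x_k = x_l = 0, [phi s] sorts monomials by their degree in x_k and x_l,
    so the order of vanishing can be read off the support. *)
Lemma mcoeff_phi f n m : ((phi s f)`_n)@_m = if (m k + m l == n)%N then f@_m else 0.
Proof.
rewrite {1}(mpolyE f) rmorph_sum coef_sum raddf_sum /=.
rewrite [f in RHS](mpolyE f) raddf_sum /=.
transitivity (\sum_(m0 <- msupp f) (f@_m0 * (m0 == m)%:R) *+ (m k + m l == n)%N).
  apply: eq_bigr => m0 _.
  rewrite -mul_mpolyC rmorphM /= phiC coefCM phi_monomial coefXnM coefC mcoeffCM.
  case: (ltnP n (m0 k + m0 l)) => [lt|ge]; last rewrite subn_eq0.
    rewrite mcoeff0 mulr0; case: (m0 =P m) lt => [->|_ _]; last by rewrite mulr0 mul0rn.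
    by rewrite ltn_neqAle eq_sym => /andP[/negbTE-> _]; rewrite mulr0n.
  case: (leqP n _) => le.
    have -> : n = (m0 k + m0 l)%N by apply/eqP; rewrite eqn_leq le ge.
    rewrite mcoeffX; case: (m0 =P m) => [->|_]; last by rewrite mulr0 mul0rn.
    by rewrite eqxx.
  rewrite mcoeff0 mulr0; case: (m0 =P m) le => [->|_ _]; last by rewrite mulr0 mul0rn.
  by rewrite ltn_neqAle => /andP[/negbTE-> _]; rewrite mulr0n.
case: ifP => _; last by rewrite big1 // => m0 _; rewrite mulr0n.
by apply: eq_bigr => m0 _; rewrite mcoeffZ mcoeffX.
Qed.

Lemma ord_ge_msupp f n m : ord_ge s n f -> m \in msupp f -> (n <= m k + m l)%N.
Proof.
move=> [q Eq]; rewrite mcoeff_msupp leqNgt; apply: contraNN => ltmn.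
have := mcoeff_phi f (m k + m l) m; rewrite eqxx => <-.
by rewrite Eq coefMXn ltmn mcoeff0.
Qed.

(** Every monomial has degree at least n in x_k and x_l, so at most deg f - n is left for x_i and
    x_j, which both become multiples of x_j. *)
Lemma size_rho f n : ord_ge s n f -> rho i j a f != 0 ->
  (size (rho i j a f) + n <= msize f)%N.
Proof.
move=> fn f0.
have deg m : m \in msupp f -> (m i + m j + n < msize f)%N.
  move=> mf; apply: leq_ltn_trans (msize_mdeg_lt mf).
  rewrite mdegE (big_ord4_perm _ _ ijkl) !big_cons big_nil /= addn0 addnA leq_add2l.
  exact: ord_ge_msupp fn mf.
(* Ensures that the subtraction [msize f - n] is not truncated. *)
have nf : (n <= msize f)%N.
  case E: (msupp f) => [|m r].
    by move: f0; rewrite (mpolyE f) E big_nil rmorph0 eqxx.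
  apply: leq_trans (ltnW (deg m _)); first exact: leq_addl.
  by rewrite E mem_head.
rewrite -(subnK nf) leq_add2r.
have -> : rho i j a f = \sum_(m <- msupp f) rho i j a (f@_m *: 'X_[m]).
  by rewrite {1}(mpolyE f) rmorph_sum.
apply: leq_trans (size_sum _ _ _) _; apply/bigmax_leqP_seq => m mf _.
rewrite leq_subRL // addnC; apply: leq_trans (deg m mf).
rewrite -addSn leq_add2r.
have Em : 'X_[m] = X4 i ^+ m i * X4 j ^+ m j * X4 k ^+ m k * X4 l ^+ m l.
  by rewrite -[LHS]comp_mpoly_id /comp_mpoly (monomial_ord4 _ _ _ ijkl) !tnth_mktuple.
have [Ri Rj Rk Rl] := rsub_at.
have -> : rho i j a (f@_m *: 'X_[m]) =
    ((f@_m)%:MP * a%:MP ^+ m i * X4 k ^+ m k * X4 l ^+ m l)%:P * 'X^(m i + m j).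
  rewrite -mul_mpolyC Em 4!rhoM 4!rmorphXn !rhoX rhoC Ri Rj Rk Rl 3!polyCM 3!polyC_exp.
  rewrite exprMn exprD.
  move: (X4 k)%:P (X4 l)%:P (a%:MP)%:P ((f@_m)%:MP)%:P => x y z t; ring.
apply: leq_trans (size_polyMleq _ _) _; rewrite size_polyXn addnS /=.
apply: leq_trans (leq_add (size_polyC_leq1 _) (leqnn _)) _.
by rewrite add1n.
Qed.
End Degree.

Definition all_ord (n : nat) (f : R4) : Prop :=
  forall i j k l a b, is_line i j k l a b -> ord_ge (lsub i j k a b) n f.

Lemma multiples_is_ideal (S : comNzRingType) (g : {rmorphism R4 -> S}) (u : S) :
  is_ideal (fun h => exists w, g h = w * u).
Proof.
split; first by exists 0; rewrite rmorph0 mul0r.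
split=> [p q [v Ev] [w Ew] | r p [v Ev]].
  by exists (v + w); rewrite rmorphD Ev Ew mulrDl.
by exists (g r * v); rewrite rmorphM Ev mulrA.
Qed.

Lemma mpolyC_inj4 (b c : CC) (x : R4) : x != 0 -> b%:MP * x = c%:MP * x -> b = c.
Proof. by move=> x0 /(mulIf x0)/eqP; rewrite mpolyC_eq => /eqP. Qed.

Lemma rho_linear i j a p r c :
  rho i j a (X4 p - c%:MP * X4 r) = rsub i j a p - (c%:MP)%:P * rsub i j a r.
Proof. by rewrite rhoB rhoX rhoM rhoC rhoX. Qed.

(** * Vanishing on the planes in low degree *)

Section Hyperplane.
Variables (i j k l : 'I_4) (a : CC) (f : R4) (n : nat).
Hypotheses (ijkl : uniq [:: i; j; k; l]) (a3 : a ^+ 3 = 1) (fn : all_ord n f).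

Lemma rho_multiple p q r t c d (u : {poly R4}) : is_line p q r t c d ->
  (exists w, rho i j a (X4 p - c%:MP * X4 r) = w * u) ->
  (exists w, rho i j a (X4 q - d%:MP * X4 r) = w * u) ->
  exists w, rho i j a f = w * u ^+ n.
Proof.
move=> L Hp Hq; apply: ord_ge_restrict (fn L).
exact: (lsub_gen_mem (multiples_is_ideal _ _)) Hp Hq.
Qed.

(** This root comes from the coordinate line x_i = x_j = 0, which lies in the plane. *)
Lemma rho_root0 : exists w, rho i j a f = w * ('X - 0%:P) ^+ n.
Proof.
have [Ri Rj _ _] := rsub_at a ijkl.
apply: (@rho_multiple i j k l 0 0); first by split; [exact: ijkl | left].
- rewrite rho_linear Ri mpolyC0 polyC0 [X in _ - X]mul0r !subr0.
  by exists (a%:MP)%:P.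
- rewrite rho_linear Rj mpolyC0 polyC0 [X in _ - X]mul0r.
  by exists 1; rewrite [RHS]mul1r.
Qed.

(** The line x_i = ab x_m, x_j = b x_m lies in the plane x_i = a x_j, where its equation is x_j = b
    x_m. *)
Lemma rho_root m b t : uniq [:: i; j; m; t] -> b ^+ 3 = 1 ->
  exists w, rho i j a f = w * ('X - (b%:MP * X4 m)%:P) ^+ n.
Proof.
move=> ijmt b3; have [Ri Rj Rm _] := rsub_at a ijmt.
apply: (@rho_multiple i j m t (a * b) b).
- by split; [exact: ijmt | right]; rewrite exprMn a3 b3 mul1r.
- exists (a%:MP)%:P; rewrite rho_linear Ri Rm.
  by rewrite mpolyCM 2!polyCM mulrBr mulrA.
- by exists 1; rewrite rho_linear Rj Rm [RHS]mul1r polyCM.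
Qed.

Lemma X4_scaled_neq (p q : 'I_4) (b c : CC) : p != q -> b != 0 ->
  b%:MP * X4 p != c%:MP * X4 q.
Proof.
move=> pq b0; apply/eqP => /(congr1 (mcoeff U_(p))).
rewrite 2!mcoeffCM 2!mcoeffXU eqxx eq_sym (negbTE pq) mulr1 mulr0.
by move/eqP: b0.
Qed.

Lemma rho_eq0 : (msize f <= 8 * n)%N -> rho i j a f = 0.
Proof.
move=> small; apply/eqP; apply: contraTT small => f0; rewrite -ltnNge.
have [ijlk klij] := uniq4_blocks ijkl.
have kl : k != l by move: ijkl; rewrite /= !inE => /and4P[_ _ + _].
have [rs [urs srs rs3 _]] := cube_roots.
have rs0 b : b \in rs -> b != 0 by move/rs3/cube_root_neq0.
(* The line x_k = x_l = 0, not in the plane, lowers the degree by n; with seven roots of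
   multiplicity n this makes 8 n. *)
have L0 : is_line k l i j 0 0 by split; [exact: klij | left].
have := size_rho ijkl (fn L0) f0; apply: leq_trans.
pose R := 0 :: [seq b%:MP * X4 k | b <- rs] ++ [seq b%:MP * X4 l | b <- rs].
have -> : (8 * n = n * size R + n)%N.
  by rewrite /= size_cat !size_map srs -mulnSr mulnC.
rewrite -addSn leq_add2r; apply: size_gt_multiplicities => //.
  rewrite /R cons_uniq mem_cat cat_uniq !map_inj_uniq ?urs /= ?andbT.
  - rewrite negb_or -andbA; apply/and3P; split.
    + apply/mapP => -[b /rs0 b0 /esym/eqP].
      by rewrite mulf_eq0 mpolyC_eq0 (negbTE b0); apply/negP/X4_neq0.
    + apply/mapP => -[b /rs0 b0 /esym/eqP].
      by rewrite mulf_eq0 mpolyC_eq0 (negbTE b0); apply/negP/X4_neq0.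
    + apply/hasPn => _ /mapP[b /rs0 b0 ->]; apply/mapP => -[c _ /eqP].
      by apply/negP; apply: X4_scaled_neq _ b0; rewrite eq_sym.
  - by move=> b c; apply: mpolyC_inj4 (X4_neq0 _).
  - by move=> b c; apply: mpolyC_inj4 (X4_neq0 _).
move=> r; rewrite inE mem_cat => /or3P[/eqP->|/mapP[b /rs3 b3 ->]|/mapP[b /rs3 b3 ->]].
- exact: rho_root0.
- exact: rho_root ijkl b3.
- exact: rho_root ijlk b3.
Qed.

Lemma hyperplane_dvd : (msize f <= 8 * n)%N -> psi (hsub i j a) f = 0.
Proof. by move/rho_eq0 => f0; rewrite -rho_at f0 horner0. Qed.

End Hyperplane.

Lemma hsub_ideal i j a f : psi (hsub i j a) f = 0 -> exists g, f = (X4 i - a%:MP * X4 j) * g.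
Proof.
move=> f0; rewrite -[f]subr0 -f0.
have idJ := multiples_is_ideal (idfun : {rmorphism R4 -> R4}) (X4 i - a%:MP * X4 j).
have [|g Eg] := sub_psi_mem f idJ (s := hsub i j a).
  move=> m; rewrite /hsub; case: eqP => [->|_]; first by exists 1; rewrite mul1r.
  by exists 0; rewrite subrr mul0r.
by exists g; rewrite mulrC -Eg.
Qed.

Lemma ord4_complement (i j : 'I_4) : i != j -> exists k l, uniq [:: i; j; k; l].
Proof.
by case: (ord4E i) => ->; case: (ord4E j) => -> //= _;
 first [by exists 0, 1 | by exists 0, 2 | by exists 0, 3
       | by exists 1, 2 | by exists 1, 3 | by exists 2, 3].
Qed.

(** * Divisibility by the product of the planes *)

Definition lin (t : 'I_4 * 'I_4 * CC) : R4 := X4 t.1.1 - (t.2)%:MP * X4 t.1.2.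

Definition hyp (t : 'I_4 * 'I_4 * CC) : {rmorphism R4 -> R4} := psi (hsub t.1.1 t.1.2 t.2).

Lemma mcoeff_hsub i j a m p : p != j -> m != p -> mcoeff U_(p) (hsub i j a m) = 0.
Proof.
move=> pj mp; rewrite /hsub; case: (m == i).
  by rewrite mcoeffCM mcoeffXU eq_sym (negbTE pj) mulr0.
by rewrite mcoeffXU (negbTE mp).
Qed.

Lemma mcoeff_hsub_diag i j a p : p != i -> mcoeff U_(p) (hsub i j a p) = 1.
Proof. by move=> pi; rewrite /hsub (negbTE pi) mcoeffXU eqxx. Qed.

(** With the indices ordered, a plane determines its triple, so the form of one plane does not
    vanish on another. *)
Lemma hyp_lin_neq0 (t u : 'I_4 * 'I_4 * CC) : (t.1.1 < t.1.2)%N -> (u.1.1 < u.1.2)%N -> u.2 != 0 ->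
  t != u -> hyp t (lin u) != 0.
Proof.
case: t u => [[i j] a] [[p q] b] /= ij pq b0 tu.
rewrite /hyp /lin /= psiB psiM psiC psiX psiX.
have pq' : q != p by rewrite -val_eqE /= gtn_eqF.
have [pi|pi] := eqVneq p i; last have [pj|pj] := eqVneq p j.
- subst p; have [qj|qj] := eqVneq q j.
    subst q; rewrite /hsub eqxx (negbTE pq') -mulrBl mulf_neq0 ?X4_neq0 // -mpolyCB mpolyC_eq0.
    by rewrite subr_eq0; apply: contraNneq tu => ->.
  apply/eqP => /(congr1 (mcoeff U_(q))).
  rewrite mcoeffB mcoeffCM (@mcoeff_hsub i j a i q) 1?[i == q]eq_sym // mcoeff_hsub_diag // mulr1 sub0r mcoeff0.
  by move/eqP; rewrite oppr_eq0; apply/negP.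
- subst p; have qi : q != i by rewrite -val_eqE /= gtn_eqF // (ltn_trans ij).
  apply/eqP => /(congr1 (mcoeff U_(q))).
  rewrite mcoeffB mcoeffCM (@mcoeff_hsub i j a j q) 1?[j == q]eq_sym // mcoeff_hsub_diag // mulr1 sub0r mcoeff0.
  by move/eqP; rewrite oppr_eq0; apply/negP.
apply/eqP => /(congr1 (mcoeff U_(p))).
rewrite mcoeffB mcoeffCM (@mcoeff_hsub i j a q p pj pq') mcoeff_hsub_diag // mulr0 subr0 mcoeff0.
by move/eqP; apply/negP/oner_neq0.
Qed.

(** The forms already split off do not vanish on the next plane, so their cofactor does, and it is
    divisible by the next form. *)
Lemma prod_lin_dvd (s : seq ('I_4 * 'I_4 * CC)) f :
  uniq s -> (forall t, t \in s -> [/\ (t.1.1 < t.1.2)%N, t.2 != 0 & hyp t f = 0]) ->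
  exists g, f = (\prod_(t <- s) lin t) * g.
Proof.
elim: s => [|t s IH] /=; first by exists f; rewrite big_nil mul1r.
move=> /andP[ts us] Hs.
have [u us'|g Eg] := IH us; first by apply: Hs; rewrite inE us' orbT.
have [tlt t0 tf] := Hs t (mem_head t s).
have [h Eh] : exists h, g = lin t * h.
  apply: hsub_ideal; apply/eqP; move/eqP: tf; rewrite Eg /hyp psiM mulf_eq0.
  case/orP => [|/eqP->]; last by rewrite eqxx.
  rewrite rmorph_prod prodf_seq_eq0 => /hasP[u us' /= /eqP u0].
  have [ult u0' _] : [/\ (u.1.1 < u.1.2)%N, u.2 != 0 & hyp u f = 0].
    by apply: Hs; rewrite inE us' orbT.
  have tu : t != u by apply: contraNneq ts => ->.
  by case/eqP: (hyp_lin_neq0 tlt ult u0' tu).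
by exists h; rewrite big_cons Eg Eh [X in _ = X * _]mulrC -mulrA.
Qed.

Definition pairs4 : seq ('I_4 * 'I_4) := [:: (0, 1); (2, 3); (0, 2); (1, 3); (0, 3); (1, 2)].

Lemma arr_prod (S : comNzRingType) (v : 'I_4 -> S) :
  arr v 0 1 2 3 = \prod_(p <- pairs4) (v p.1 ^+ 3 - v p.2 ^+ 3).
Proof. by rewrite !big_cons big_nil /arr /cub /=; ring. Qed.

Lemma arr_dvd f :
  (forall i j a, i != j -> a ^+ 3 = 1 -> psi (hsub i j a) f = 0) ->
  exists g, f = arr X4 0 1 2 3 * g.
Proof.
move=> Hf; have [rs [urs _ rs3 Ers]] := cube_roots.
have -> : arr X4 0 1 2 3 = \prod_(t <- [seq (p, c) | p <- pairs4, c <- rs]) lin t.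
  rewrite arr_prod big_allpairs_dep; apply: eq_bigr => p _; exact: Ers.
apply: prod_lin_dvd.
  by apply: allpairs_uniq => // -[p c] [q d].
move=> t /allpairsP[[p c] /= [pP /rs3 c3 ->]] /=.
have plt : (p.1 < p.2)%N by move: p pP; apply/allP.
split=> //; first exact: cube_root_neq0.
by apply: Hf c3; rewrite -val_eqE /= ltn_eqF.
Qed.

(** * Induction on the order of vanishing *)

Lemma cub_homog i j k l : cub X4 i j k l \is 6.-homog.
Proof.
have X3 p q : X4 p ^+ 3 - X4 q ^+ 3 \is 3.-homog.
  by rewrite rpredB //; apply: (@dhomogMn _ _ _ 1 _ 3); rewrite dhomogX /= mdeg1.
exact: dhomogM (X3 i j) (X3 k l).
Qed.

Lemma arr_homog : arr X4 0 1 2 3 \is 18.-homog.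
Proof.
exact: dhomogM (dhomogM (cub_homog 0 1 2 3) (cub_homog 0 2 1 3)) (cub_homog 0 3 1 2).
Qed.

Lemma arr_neq0 : arr X4 0 1 2 3 != 0.
Proof. by rewrite /arr /cub !mulf_neq0 ?X4_cubeB_neq0. Qed.

Lemma msize_homog d (f : R4) : f != 0 -> f \is d.-homog -> msize f = d.+1.
Proof.
move=> f0 fd; have := dhomog_uniq f0 fd (dhomog_msize fd).
by move=> ->; rewrite prednK // lt0n msize_poly_eq0.
Qed.

Lemma sign_cancel (S : comNzRingType) (e : bool) (x y G u q : S) :
  (-1) ^+ e * (x * G) * u = q * (x * y) -> x * (G * u) = x * ((-1) ^+ e * q * y).
Proof.
move=> E; have -> : x * (G * u) = (-1) ^+ e * ((-1) ^+ e * (x * G) * u).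
  by case: e {E}; ring.
by rewrite E; ring.
Qed.

(** The order of [arr] along each line is exactly 3, so its cofactor loses no more than that. *)
Lemma all_ord_arr n g : all_ord (3 + n) (arr X4 0 1 2 3 * g) -> all_ord n g.
Proof.
move=> H i j k l a b L; have [q Eq] := H _ _ _ _ _ _ L.
have [e arrE] := arr_sym X4 (proj1 L); have [G [EG G0]] := line_arr_order L.
move: Eq; rewrite arrE 2!rmorphM EG => Eq.
apply: (cancel_X_exp G0 (q := (-1) ^+ e * q)).
have X3 : 'X^3 != 0 :> {poly R4} by rewrite -size_poly_eq0 size_polyXn.
apply: (mulfI X3); move: Eq; rewrite rmorphXn rmorphN1 exprD.
exact: sign_cancel.
Qed.

Lemma msize_lower_bound n f : f != 0 -> all_ord n f ->
  (18 * (n %/ 3) + 8 * (n %% 3) < msize f)%N.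
Proof.
have [N] := ubnP n; elim: N n f => // N IH n f leN f0 fn.
(* In degree at least 8 n the bound follows from 18 <= 3 * 8. *)
have [small|large] := leqP (msize f) (8 * n); last first.
  by apply: leq_ltn_trans large; rewrite {3}(divn_eq n 3); lia.
have [i j a ij a3|g Eg] := @arr_dvd f.
  have [k [l ijkl]] := ord4_complement ij.
  exact: hyperplane_dvd ijkl a3 fn small.
have g0 : g != 0 by apply: contraNneq f0 => g0; rewrite Eg g0 mulr0.
have -> : msize f = (18 + msize g)%N.
  by rewrite Eg msizeM ?arr_neq0 // (msize_homog arr_neq0 arr_homog).
have g1 : (0 < msize g)%N by rewrite lt0n msize_poly_eq0.
(* For n <= 2, a nonzero multiple of [arr] has degree at least 18, above 8 n <= 16. *)
have [n3|n3] := ltnP n 3; first by rewrite divn_small // modn_small //; lia.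
have En : n = (3 + (n - 3))%N by rewrite subnKC.
have := IH (n - 3)%N g _ g0 (all_ord_arr _).
rewrite -En -Eg => /(_ _ fn) lower.
rewrite En divnDl // modnDl divnn /=.
have : (18 * ((n - 3) %/ 3) + 8 * ((n - 3) %% 3) < msize g)%N by apply: lower; lia.
lia.
Qed.

Lemma symb_pow_lower_bound n f d : symb_pow I3 n f -> f != 0 -> f \is d.-homog ->
  (18 * (n %/ 3) + 8 * (n %% 3) <= d)%N.
Proof.
move=> In f0 fd; rewrite -ltnS -(msize_homog f0 fd); apply: msize_lower_bound => //.
by move=> i j k l a b L; apply: symb_pow_ord L _ _ In.
Qed.

(** * I3 is the ideal of the lines *)

Section CompleteIntersection.
Variable A : comNzRingType.

Definition two_gen (u v f : A) : Prop := exists p q, f = p * u + q * v.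

Lemma two_genD u v f g : two_gen u v f -> two_gen u v g -> two_gen u v (f + g).
Proof. by move=> [p [q ->]] [p' [q' ->]]; exists (p + p'), (q + q'); ring. Qed.

Lemma two_genM u v r f : two_gen u v f -> two_gen u v (r * f).
Proof. by move=> [p [q ->]]; exists (r * p), (r * q); ring. Qed.

Lemma two_genN u v f : two_gen u v f -> two_gen u v (- f).
Proof. by rewrite -mulN1r; apply: two_genM. Qed.

Lemma two_gen_l u v : two_gen u v u. Proof. by exists 1, 0; ring. Qed.
Lemma two_gen_r u v : two_gen u v v. Proof. by exists 0, 1; ring. Qed.

Definition prime_pair (u v : A) : Prop :=
  ~ two_gen u v 1 /\ forall f g, two_gen u v (f * g) -> two_gen u v f \/ two_gen u v g.

Lemma prime_pair_prod (I : eqType) (s : seq I) (F : I -> A) u v : prime_pair u v ->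
  (forall i, i \in s -> ~ two_gen u v (F i)) -> ~ two_gen u v (\prod_(i <- s) F i).
Proof.
move=> [uv1 uvM]; elim: s => [|i s IH] Fs; first by rewrite big_nil.
rewrite big_cons => /uvM[|]; first by apply: Fs; rewrite mem_head.
by apply: IH => t ts; apply: Fs; rewrite inE ts orbT.
Qed.

(** Write f = p u + q M with M the product of the other m_t. Then q M lies in the prime (u, m_j),
    which contains none of these m_t, so q lies in it. *)
Lemma two_gen_prodr (J : eqType) (s : seq J) (m : J -> A) u f : uniq s ->
  (forall j, j \in s -> prime_pair u (m j)) ->
  (forall j t, j \in s -> t \in s -> j != t -> ~ two_gen u (m j) (m t)) ->
  (forall j, j \in s -> two_gen u (m j) f) -> two_gen u (\prod_(j <- s) m j) f.
Proof.
elim: s => [|j s IH] /=; first by exists 0, f; rewrite big_nil; ring.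
move=> /andP[js us] pr inc fs.
have sub t : t \in s -> t \in j :: s by rewrite inE => ->; rewrite orbT.
have [|||p [q Ef]] := IH us.
- by move=> t ts; apply: pr; apply: sub.
- by move=> t t' ts ts'; apply: inc; apply: sub.
- by move=> t ts; apply: fs; apply: sub.
have prj := pr j (mem_head _ _).
have : two_gen u (m j) (q * \prod_(t <- s) m t).
  have -> : q * \prod_(t <- s) m t = f + - (p * u) by rewrite Ef; ring.
  by apply: two_genD (fs j (mem_head _ _)) _; apply/two_genN/two_genM/two_gen_l.
move=> /(proj2 prj)[[p' [q' Eq]] | ]; last first.
  move=> /(prime_pair_prod prj)[] t ts.
  apply: inc; [exact: mem_head | exact: sub | by apply: contraNneq js => ->].
exists (p + p' * \prod_(t <- s) m t), q'; rewrite big_cons Ef Eq; ring.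
Qed.

(* The product of the l_i is peeled off one factor at a time: if f = p L + q M also lies
   in every (l_i, m_j), then so does p, because L does not. *)
Lemma two_gen_prod (I J : eqType) (si : seq I) (sj : seq J) (l : I -> A) (m : J -> A) f :
  uniq si -> uniq sj ->
  (forall i j, i \in si -> j \in sj -> prime_pair (l i) (m j)) ->
  (forall i j t, i \in si -> j \in sj -> t \in sj -> j != t ->
     ~ two_gen (l i) (m j) (m t)) ->
  (forall i j t, i \in si -> j \in sj -> t \in si -> i != t ->
     ~ two_gen (l i) (m j) (l t)) ->
  (forall i j, i \in si -> j \in sj -> two_gen (l i) (m j) f) ->
  two_gen (\prod_(i <- si) l i) (\prod_(j <- sj) m j) f.
Proof.
move=> + usj; elim: si => [|i s IH] /=; first by exists f, 0; rewrite big_nil; ring.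
move=> /andP[is_ us] pr incm incl fs.
have sub t : t \in s -> t \in i :: s by rewrite inE => ->; rewrite orbT.
have hd := mem_head i s.
have [||||p [q Ef]] := IH us.
- by move=> t j ts; apply: pr; apply: sub.
- by move=> t j j' ts; apply: incm; apply: sub.
- by move=> t j t' ts js ts'; apply: incl => //; apply: sub.
- by move=> t j ts; apply: fs; apply: sub.
set L := \prod_(t <- s) l t in Ef; set M := \prod_(j <- sj) m j in Ef.
have pij : forall j, j \in sj -> two_gen (l i) (m j) p.
  move=> j js; have prj := pr i j hd js.
  have : two_gen (l i) (m j) (p * L).
    have -> : p * L = f + - (q * M) by rewrite Ef; ring.
    apply: two_genD (fs i j hd js) _; apply/two_genN/two_genM.
    by rewrite /M (big_rem j) //= mulrC; apply/two_genM/two_gen_r.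
  move=> /(proj2 prj)[// | /(prime_pair_prod prj)[] t ts].
  by apply: incl => //; [exact: sub | apply: contraNneq is_ => ->].
have [p' [q' Ep]] : two_gen (l i) M p.
  apply: (two_gen_prodr usj) pij; first by move=> j; apply: pr.
  by move=> j t js ts; apply: incm.
by exists p', (q' * L + q); rewrite big_cons -/L -/M Ef Ep -/M; ring.
Qed.
End CompleteIntersection.

(** * The 36 lines where a plane of A meets a plane of C *)

Section LinePoints.
Variable K : fieldType.
Implicit Types i j t : bool * K.

(** The linear factors of A, and next those of C: the boolean selects the cube difference, the
    scalar the factor in it. *)
Definition formA (v : 'I_4 -> K) i := if i.1 then v 0 - i.2 * v 1 else v 2 - i.2 * v 3.
Definition formC (v : 'I_4 -> K) j := if j.1 then v 0 - j.2 * v 3 else v 1 - j.2 * v 2.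

(* A point of the line formA i = formC j = 0 lying on none of the other hyperplanes. *)
Definition line_point i j : 'I_4 -> K :=
  let c := i.2 in let d := j.2 in
  nth 0 (match i.1, j.1 with
         | true, true => [:: 1; c ^+ 2; 0; d ^+ 2]
         | true, false => [:: c; 1; d ^+ 2; 0]
         | false, true => [:: d; 0; c; 1]
         | false, false => [:: 0; d; 1; c ^+ 2]
         end).

(** Evaluation at this point shows that no other factor of A or C lies in the ideal of the line, as
    [two_gen_prod] requires. *)
Lemma line_pointP i j : i.2 ^+ 3 = 1 -> j.2 ^+ 3 = 1 ->
  [/\ formA (line_point i j) i = 0, formC (line_point i j) j = 0,
      forall t, t.2 ^+ 3 = 1 -> j != t -> formC (line_point i j) t != 0 &
      forall t, t.2 ^+ 3 = 1 -> i != t -> formA (line_point i j) t != 0].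
Proof.
have inv_root (c d : K) : c ^+ 3 = 1 -> 1 - d * c ^+ 2 = 0 -> c = d.
  move=> c3 /eqP; rewrite subr_eq0 => /eqP E.
  by rewrite -[c]mul1r E -mulrA -exprSr c3 mulr1.
case: i j => [e c] [e' d] /= c3 d3; have [c0 d0] := (cube_root_neq0 c3, cube_root_neq0 d3).
rewrite /formA /formC /line_point; case: e; case: e' => /=; split;
  rewrite ?mulr1 ?mulr0 ?subrr -?exprS ?c3 ?d3 ?subrr //; case=> [[] g] /= /cube_root_neq0 g0 ne.
all: rewrite ?(mulr1, mulr0, subr0, sub0r, oppr_eq0) ?mulf_neq0 ?expf_neq0 //.
all: try by (rewrite subr_eq0; apply: contraNneq ne => ->).
all: by apply: contraNneq ne => E; rewrite (inv_root _ _ _ E).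
Qed.
End LinePoints.

Definition linA (i : bool * CC) : R4 :=
  if i.1 then X4 0 - (i.2)%:MP * X4 1 else X4 2 - (i.2)%:MP * X4 3.
Definition linC (j : bool * CC) : R4 :=
  if j.1 then X4 0 - (j.2)%:MP * X4 3 else X4 1 - (j.2)%:MP * X4 2.

Lemma meval_lin (v : 'I_4 -> CC) p q c : meval v (X4 p - c%:MP * X4 q) = v p - c * v q.
Proof. by rewrite mevalB mevalM mevalC !mevalXU. Qed.

Lemma meval_linA v i : meval v (linA i) = formA v i.
Proof. by rewrite /linA /formA; case: i.1; apply: meval_lin. Qed.

Lemma meval_linC v j : meval v (linC j) = formC v j.
Proof. by rewrite /linC /formC; case: j.1; apply: meval_lin. Qed.

Lemma two_gen_meval (v : 'I_4 -> CC) (u w f : R4) :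
  two_gen u w f -> meval v u = 0 -> meval v w = 0 -> meval v f = 0.
Proof. by move=> [p [q ->]] u0 w0; rewrite mevalD 2!mevalM u0 w0 !mulr0 addr0. Qed.

Lemma two_gen_line p q r t a b (u v : R4) : is_line p q r t a b ->
  psi (lsub p q r a b) u = 0 -> psi (lsub p q r a b) v = 0 ->
  (exists e, X4 p - a%:MP * X4 r = e * u) -> (exists e, X4 q - b%:MP * X4 r = e * v) ->
  forall f, two_gen u v f <-> psi (lsub p q r a b) f = 0.
Proof.
move=> L u0 v0 [e Eu] [e' Ev] f; split.
  move=> [x [y ->]]; have idP := psi_is_ideal p q r a b.
  exact: (idealD idP (idealMl idP x u0) (idealMl idP y v0)).
by move=> /line_ideal [x [y ->]]; exists (x * e), (y * e'); rewrite Eu Ev !mulrA.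
Qed.

Lemma linear_swap (S : comNzRingType) (d x y : S) : d ^+ 3 = 1 ->
  x - d ^+ 2 * y = - d ^+ 2 * (y - d * x).
Proof. by move=> d3; rewrite -[x in LHS]mul1r -d3; ring. Qed.

Lemma lin_swap (c : CC) p r : c ^+ 3 = 1 ->
  exists e, X4 p - (c ^+ 2)%:MP * X4 r = e * (X4 r - c%:MP * X4 p).
Proof.
move/mpolyC_cube => c3; exists (- c%:MP ^+ 2); rewrite rmorphXn.
exact: linear_swap.
Qed.

(** The two forms share one variable, which becomes the parameter of the line. Each form is solved
    for its other variable, if necessary with the inverse root c^2. *)
Lemma linAC_line i j : i.2 ^+ 3 = 1 -> j.2 ^+ 3 = 1 ->
  exists p q r t a b, is_line p q r t a b /\
    forall f, two_gen (linA i) (linC j) f <-> psi (lsub p q r a b) f = 0.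
Proof.
have lin1 (c : CC) p r : exists e, X4 p - c%:MP * X4 r = e * (X4 p - c%:MP * X4 r).
  by exists 1; rewrite mul1r.
have psi1 s p r c : s p = c%:MP * s r -> psi s (X4 p - c%:MP * X4 r) = 0.
  by move=> sp; rewrite psiB psiM psiC 2!psiX sp subrr.
have psi2 s p r c : c ^+ 3 = 1 -> s p = (c ^+ 2)%:MP * s r -> psi s (X4 r - c%:MP * X4 p) = 0.
  move=> c3 sp; rewrite psiB psiM psiC 2!psiX sp mulrA -mpolyCM -exprS c3 mpolyC1 mul1r.
  exact: subrr.
have sq (c : CC) : c ^+ 3 = 1 -> (c ^+ 2) ^+ 3 = 1.
  by move=> c3; rewrite -exprM mulnC exprM c3 expr1n.
case: i j => [[] c] [[] d] /= c3 d3; rewrite /linA /linC /=.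
- exists 1, 3, 0, 2, (c ^+ 2), (d ^+ 2).
  have L : is_line 1 3 0 2 (c ^+ 2) (d ^+ 2) by split=> //; right; split; apply: sq.
  have [Ep Eq Er _] := lsub_at (c ^+ 2) (d ^+ 2) (proj1 L).
  split; [exact: L | apply: (two_gen_line L)].
  + by apply: psi2 => //; rewrite Ep Er.
  + by apply: psi2 => //; rewrite Eq Er.
  + exact: lin_swap.
  + exact: lin_swap.
- exists 0, 2, 1, 3, c, (d ^+ 2).
  have L : is_line 0 2 1 3 c (d ^+ 2) by split=> //; right; split=> //; apply: sq.
  have [Ep Eq Er _] := lsub_at c (d ^+ 2) (proj1 L).
  split; [exact: L | apply: (two_gen_line L)].
  + by apply: psi1 => //; rewrite Ep Er.
  + by apply: psi2 => //; rewrite Eq Er.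
  + exact: lin1.
  + exact: lin_swap.
- exists 2, 0, 3, 1, c, d.
  have L : is_line 2 0 3 1 c d by split=> //; right.
  have [Ep Eq Er _] := lsub_at c d (proj1 L).
  split; [exact: L | apply: (two_gen_line L)].
  + by apply: psi1 => //; rewrite Ep Er.
  + by apply: psi1 => //; rewrite Eq Er.
  + exact: lin1.
  + exact: lin1.
- exists 3, 1, 2, 0, (c ^+ 2), d.
  have L : is_line 3 1 2 0 (c ^+ 2) d by split=> //; right; split=> //; apply: sq.
  have [Ep Eq Er _] := lsub_at (c ^+ 2) d (proj1 L).
  split; [exact: L | apply: (two_gen_line L)].
  + by apply: psi2 => //; rewrite Ep Er.
  + by apply: psi1 => //; rewrite Eq Er.
  + exact: lin_swap.
  + exact: lin1.
Qed.

Definition on_lines (f : R4) : Prop :=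
  forall i j k l a b, is_line i j k l a b -> psi (lsub i j k a b) f = 0.

Lemma on_lines_two_gen f : on_lines f -> two_gen (cub X4 0 1 2 3) (cub X4 0 3 1 2) f.
Proof.
move=> fL; have [rs [urs _ rs3 Ers]] := cube_roots.
pose si := [seq (b, c) | b <- [:: true; false], c <- rs].
have usi : uniq si by apply: allpairs_uniq => // -[? ?] [? ?].
have si3 i : i \in si -> i.2 ^+ 3 = 1 by case/allpairsP=> -[b c] /= [_ /rs3 c3 ->].
have -> : cub X4 0 1 2 3 = \prod_(i <- si) linA i.
  by rewrite /cub (Ers (X4 0)) (Ers (X4 2)) big_allpairs_dep big_cons big_seq1.
have -> : cub X4 0 3 1 2 = \prod_(i <- si) linC i.
  by rewrite /cub (Ers (X4 0)) (Ers (X4 1)) big_allpairs_dep big_cons big_seq1.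
apply: two_gen_prod => //.
- move=> i j /si3 i3 /si3 j3; have [p [q [r [t [a [b [L E]]]]]]] := linAC_line i3 j3.
  split; first by move/E; rewrite rmorph1; apply/eqP/oner_neq0.
  move=> g h /E/eqP; rewrite psiM mulf_eq0 => /orP[]/eqP H; [left | right]; exact/E.
- move=> i j t /si3 i3 /si3 j3 /si3 t3 jt H; have [A0 C0 Ct _] := line_pointP i3 j3.
  case/eqP: (Ct t t3 jt); rewrite -meval_linC.
  by apply: two_gen_meval H _ _; rewrite ?meval_linA ?meval_linC.
- move=> i j t /si3 i3 /si3 j3 /si3 t3 it H; have [A0 C0 _ At] := line_pointP i3 j3.
  case/eqP: (At t t3 it); rewrite -meval_linA.
  by apply: two_gen_meval H _ _; rewrite ?meval_linA ?meval_linC.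
move=> i j /si3 i3 /si3 j3; have [p [q [r [t [a [b [L E]]]]]]] := linAC_line i3 j3.
by apply/E; apply: fL L.
Qed.

(** * Vanishing on the coordinate lines *)

(** On a coordinate line one of A, C and A + C is zero, and the other two are, up to sign, the
    product of the cubes of the remaining coordinates. *)
Lemma coordinate_syzygy (D : idomainType) (v : 'I_4 -> D) (P Q : D) :
  P * cub v 0 1 2 3 + Q * cub v 0 3 1 2 = 0 ->
  [/\ v 0 = 0 -> v 1 = 0 -> v 2 != 0 -> v 3 != 0 -> Q = 0,
      v 2 = 0 -> v 3 = 0 -> v 0 != 0 -> v 1 != 0 -> Q = 0,
      v 0 = 0 -> v 3 = 0 -> v 1 != 0 -> v 2 != 0 -> P = 0 &
      v 1 = 0 -> v 2 = 0 -> v 0 != 0 -> v 3 != 0 -> P = 0] /\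
  [/\ v 0 = 0 -> v 2 = 0 -> v 1 != 0 -> v 3 != 0 -> P - Q = 0 &
      v 1 = 0 -> v 3 = 0 -> v 0 != 0 -> v 2 != 0 -> P - Q = 0].
Proof.
move=> E.
have cancel (r x y : D) : x != 0 -> y != 0 -> r * (x ^+ 3 * y ^+ 3) = 0 -> r = 0.
  move=> x0 y0 r0; apply: (mulIf (mulf_neq0 (expf_neq0 3 x0) (expf_neq0 3 y0))).
  by rewrite r0 mul0r.
have cancelN (r x y : D) : x != 0 -> y != 0 -> r * (x ^+ 3 * y ^+ 3) = - 0 -> r = 0.
  by rewrite oppr0; apply: cancel.
move: E; rewrite /cub => E; split; split=> u w x0 y0; rewrite u w in E.
- by apply: (cancel _ _ _ x0 y0); rewrite -E; ring.
- by apply: (cancel _ _ _ x0 y0); rewrite -E; ring.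
- by apply: (cancelN _ _ _ x0 y0); rewrite -E; ring.
- by apply: (cancelN _ _ _ x0 y0); rewrite -E; ring.
- by apply: (cancel _ _ _ x0 y0); rewrite -E; ring.
- by apply: (cancel _ _ _ x0 y0); rewrite -E; ring.
Qed.

Lemma rmorph_cub (A B : comNzRingType) (f : {rmorphism A -> B}) (v : 'I_4 -> A) i j k l :
  f (cub v i j k l) = cub (f \o v) i j k l.
Proof. by rewrite /cub rmorphM !rmorphB !rmorphXn. Qed.

Lemma coordinate_line_vanish i j k l (p q : R4) :
  uniq [:: i; j; k; l] -> on_lines (p * cub X4 0 1 2 3 + q * cub X4 0 3 1 2) ->
  let s := lsub k l i 0 0 in
  [/\ psi s p * cub (psi s \o X4) 0 1 2 3 + psi s q * cub (psi s \o X4) 0 3 1 2 = 0,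
      psi s (X4 k) = 0 /\ psi s (X4 l) = 0, psi s (X4 i) != 0 & psi s (X4 j) != 0].
Proof.
move=> ijkl H s; have [_ klij] := uniq4_blocks ijkl.
have [Ek El Ei Ej] := lsub_at 0 0 klij.
have L : is_line k l i j 0 0 by split; [exact: klij | left].
split.
- apply: etrans (H _ _ _ _ _ _ L).
  apply: etrans (esym (psiD _ _ _)); congr (_ + _); apply: etrans (esym (psiM _ _ _)).
    by congr (_ * _); exact: esym (rmorph_cub (psi s) X4 0 1 2 3).
  by congr (_ * _); exact: esym (rmorph_cub (psi s) X4 0 3 1 2).
- by rewrite 2!psiX /s Ek El mpolyC0 mul0r.
- by rewrite psiX /s Ei X4_neq0.
- by rewrite psiX /s Ej X4_neq0.
Qed.

(** The ideal of a coordinate line is monomial, so vanishing there constrains each monomial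
    separately. *)
Lemma psi_coordinate_msupp i j k l (h : R4) m :
  uniq [:: i; j; k; l] -> psi (lsub k l i 0 0) h = 0 -> h@_m != 0 ->
  (0 < m k)%N || (0 < m l)%N.
Proof.
move=> ijkl h0; rewrite -mcoeff_msupp => mh; rewrite -addn_gt0.
by have := ord_ge_msupp ijkl (ord_ge1 h0) mh.
Qed.

Lemma monomial_split (m : 'X_{1..4}) i j : i != j -> (0 < m i)%N -> (0 < m j)%N ->
  exists h : R4, 'X_[m] = h * (X4 i * X4 j).
Proof.
move=> ij mi mj; exists 'X_[m - (U_(i) + U_(j))].
rewrite /X4 -2!mpolyXD submK //; apply/mnm_lepP => p; rewrite mnmDE 2!mnm1E.
case: eqP => [<-|_]; first by rewrite eq_sym (negbTE ij) addn0.
by case: eqP => [<-|_].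
Qed.

Lemma cub_swap (S : comNzRingType) (v : 'I_4 -> S) i j k l : cub v k l i j = cub v i j k l.
Proof. exact: mulrC. Qed.

Lemma monomial_cub_mem (m : 'X_{1..4}) i j k l : uniq [:: i; j; k; l] ->
  (0 < m i)%N && (0 < m j)%N || (0 < m k)%N && (0 < m l)%N -> I3 ('X_[m] * cub X4 i j k l).
Proof.
move=> ijkl; have [_ klij] := uniq4_blocks ijkl.
have neq (p q r t : 'I_4) : uniq [:: p; q; r; t] -> p != q.
  by rewrite /= !inE !negb_or -!andbA => /and4P[].
have mem (p q r t : 'I_4) : uniq [:: p; q; r; t] -> (0 < m p)%N && (0 < m q)%N ->
    I3 ('X_[m] * cub X4 p q r t).
  move=> pqrt /andP[mp mq]; have [h ->] := monomial_split (neq _ _ _ _ pqrt) mp mq.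
  rewrite -mulrA; apply: (idealMl (gen_is_ideal _)).
  rewrite mulrC mulrA; exact: I3_mem.
by case/orP => [|mkl]; [exact: mem | rewrite -cub_swap; exact: mem].
Qed.

(** The three-term Plücker relation in the four cubes. *)
Lemma cub_plucker (S : comNzRingType) (v : 'I_4 -> S) :
  cub v 0 2 1 3 = cub v 0 1 2 3 + cub v 0 3 1 2.
Proof. by rewrite /cub; ring. Qed.

(** If exactly one of a, c and a - c is zero, the combination is a multiple of u, v or u + v. The
    support of m then meets four pairs of indices forming a 4-cycle, so it contains a diagonal,
    which is what membership needs. If none is zero, it meets all six pairs, so it omits at most one
    index and both u and v are in [I3]. *)
Lemma syzygy_mem (m : 'X_{1..4}) (a c : CC) (u v : R4) :
  ((0 < m 0%R)%N && (0 < m 1%R)%N || (0 < m 2%R)%N && (0 < m 3%R)%N -> I3 u) ->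
  ((0 < m 0%R)%N && (0 < m 2%R)%N || (0 < m 1%R)%N && (0 < m 3%R)%N -> I3 (u + v)) ->
  ((0 < m 0%R)%N && (0 < m 3%R)%N || (0 < m 1%R)%N && (0 < m 2%R)%N -> I3 v) ->
  (c != 0 -> (0 < m 0%R)%N || (0 < m 1%R)%N) -> (c != 0 -> (0 < m 2%R)%N || (0 < m 3%R)%N) ->
  (a != 0 -> (0 < m 0%R)%N || (0 < m 3%R)%N) -> (a != 0 -> (0 < m 1%R)%N || (0 < m 2%R)%N) ->
  (a - c != 0 -> (0 < m 0%R)%N || (0 < m 2%R)%N) -> (a - c != 0 -> (0 < m 1%R)%N || (0 < m 3%R)%N) ->
  I3 (a%:MP * u + c%:MP * v).
Proof.
have idI3 : is_ideal I3 := gen_is_ideal _.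
move=> memA memB memC H01 H23 H03 H12 H02 H13.
have [a0|a0] := eqVneq a 0; have [c0|c0] := eqVneq c 0.
- by rewrite a0 c0 mpolyC0 mul0r mul0r addr0; case: idI3.
- rewrite a0 mpolyC0 mul0r add0r; apply: (idealMl idI3); apply: memC.
  move: (H01 c0) (H23 c0) H02 H13; rewrite a0 sub0r oppr_eq0 => + + /(_ c0) + /(_ c0).
  by clear -m; case: (0 < m 0%R)%N (0 < m 1%R)%N (0 < m 2%R)%N (0 < m 3%R)%N => [] [] [] [].
- rewrite c0 mpolyC0 mul0r addr0; apply: (idealMl idI3); apply: memA.
  move: (H03 a0) (H12 a0) H02 H13; rewrite c0 subr0 => + + /(_ a0) + /(_ a0).
  by clear -m; case: (0 < m 0%R)%N (0 < m 1%R)%N (0 < m 2%R)%N (0 < m 3%R)%N => [] [] [] [].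
have [ac|ac] := eqVneq a c.
  rewrite ac -mulrDr; apply: (idealMl idI3); apply: memB.
  move: (H01 c0) (H23 c0) (H03 a0) (H12 a0).
  by clear -m; case: (0 < m 0%R)%N (0 < m 1%R)%N (0 < m 2%R)%N (0 < m 3%R)%N => [] [] [] [].
move: ac (H01 c0) (H23 c0) (H03 a0) (H12 a0) H02 H13.
rewrite -subr_eq0 => ac h01 h23 h03 h12 /(_ ac) h02 /(_ ac) h13.
apply: (idealD idI3); apply: (idealMl idI3).
  by apply: memA; move: h01 h23 h03 h12 h02 h13; clear -m; case: (0 < m 0%R)%N (0 < m 1%R)%N (0 < m 2%R)%N (0 < m 3%R)%N => [] [] [] [].
by apply: memC; move: h01 h23 h03 h12 h02 h13; clear -m; case: (0 < m 0%R)%N (0 < m 1%R)%N (0 < m 2%R)%N (0 < m 3%R)%N => [] [] [] [].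
Qed.

Lemma monomial_syzygy_mem (m : 'X_{1..4}) (a c : CC) :
  (c != 0 -> (0 < m 0%R)%N || (0 < m 1%R)%N) -> (c != 0 -> (0 < m 2%R)%N || (0 < m 3%R)%N) ->
  (a != 0 -> (0 < m 0%R)%N || (0 < m 3%R)%N) -> (a != 0 -> (0 < m 1%R)%N || (0 < m 2%R)%N) ->
  (a - c != 0 -> (0 < m 0%R)%N || (0 < m 2%R)%N) -> (a - c != 0 -> (0 < m 1%R)%N || (0 < m 3%R)%N) ->
  I3 (a%:MP * ('X_[m] * cub X4 0 1 2 3) + c%:MP * ('X_[m] * cub X4 0 3 1 2)).
Proof.
have EB := etrans (congr1 ( *%R 'X_[m]) (cub_plucker X4)) (mulrDr _ _ _).
have memB h := eq_ind _ I3 (@monomial_cub_mem m 0 2 1 3 isT h) _ EB.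
exact: syzygy_mem (@monomial_cub_mem m 0 1 2 3 isT) memB (@monomial_cub_mem m 0 3 1 2 isT).
Qed.

Lemma on_lines_I3 f : on_lines f -> I3 f.
Proof.
have idI3 : is_ideal I3 := gen_is_ideal _.
move=> fL; have [p [q Ef]] := on_lines_two_gen fL; rewrite Ef in fL *.
(* A common bound lets p and q be expanded over the same monomials. *)
have [n [pn qn]] : exists n, (msize p <= n)%N /\ (msize q <= n)%N.
  by exists (maxn (msize p) (msize q)); rewrite leq_maxl leq_maxr.
rewrite (mpolywE pn) (mpolywE qn) 2!mulr_suml -big_split /=.
apply: (ideal_sum idI3) => m _; rewrite -2!mul_mpolyC -2!mulrA.
have pqB : (p - q)@_m = p@_m - q@_m := mcoeffB _ _ _.
(* Each of the six conditions comes from one coordinate line. *)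
apply: monomial_syzygy_mem; rewrite -?pqB.
- have [E [s0 s1] s2 s3] := @coordinate_line_vanish 2 3 0 1 p q isT fL.
  have [[H _ _ _] _] := coordinate_syzygy E.
  exact: (@psi_coordinate_msupp 2 3 0 1 _ m isT (H s0 s1 s2 s3)).
- have [E [s0 s1] s2 s3] := @coordinate_line_vanish 0 1 2 3 p q isT fL.
  have [[_ H _ _] _] := coordinate_syzygy E.
  exact: (@psi_coordinate_msupp 0 1 2 3 _ m isT (H s0 s1 s2 s3)).
- have [E [s0 s1] s2 s3] := @coordinate_line_vanish 1 2 0 3 p q isT fL.
  have [[_ _ H _] _] := coordinate_syzygy E.
  exact: (@psi_coordinate_msupp 1 2 0 3 _ m isT (H s0 s1 s2 s3)).
- have [E [s0 s1] s2 s3] := @coordinate_line_vanish 0 3 1 2 p q isT fL.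
  have [[_ _ _ H] _] := coordinate_syzygy E.
  exact: (@psi_coordinate_msupp 0 3 1 2 _ m isT (H s0 s1 s2 s3)).
- have [E [s0 s1] s2 s3] := @coordinate_line_vanish 1 3 0 2 p q isT fL.
  have [_ [H _]] := coordinate_syzygy E.
  exact: (@psi_coordinate_msupp 1 3 0 2 _ m isT (etrans (psiB _ _ _) (H s0 s1 s2 s3))).
have [E [s0 s1] s2 s3] := @coordinate_line_vanish 0 2 1 3 p q isT fL.
have [_ [_ H]] := coordinate_syzygy E.
exact: (@psi_coordinate_msupp 0 2 1 3 _ m isT (etrans (psiB _ _ _) (H s0 s1 s2 s3))).
Qed.

(** * Elements of least degree and the values of alpha *)

(* Every associated prime (I3 : g) is contained in the prime of a line on which g does
   not vanish, so it suffices to work at that line. *)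
Lemma symb_pow_arr m r g : I3 g -> symb_pow I3 (3 * m + r) (arr X4 0 1 2 3 ^+ m * g ^+ r).
Proof.
move=> Ig P [[_ [P1 _]] [g0 Pg0]].
have [i [j [k [l [a [b [L nz]]]]]]] : exists i j k l a b,
    is_line i j k l a b /\ psi (lsub i j k a b) g0 <> 0.
  apply: NNPP => noL; apply: P1; apply/Pg0; rewrite mul1r; apply: on_lines_I3.
  move=> i j k l a b L; apply: NNPP => nz; apply: noL.
  by exists i, j, k, l, a, b.
have [h [h0 _ _ Ih]] := line_witness L; have [e arrE] := arr_sym X4 (proj1 L).
(* Each factor h^3 brings one [arr] into the third power of [I3]. *)
exists ((h ^+ 3) ^+ m); split.
  move=> /Pg0 /(I3_sub_line L); rewrite psiM => /eqP; rewrite mulf_eq0.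
  case/orP => [|/eqP //]; rewrite 2!psiXn; apply/negP.
  exact: expf_neq0 (expf_neq0 _ h0).
rewrite mulrA -exprMn; apply: idpowM; last first.
  by have := idpowX r (idpow1 Ig); rewrite mul1n.
apply: idpowX; rewrite arrE mulrCA; exact: (idealMl (idpow_is_ideal _ _)).
Qed.

(** As r < 3, m and r are the quotient and remainder of the exponent by 3, so the lower bound equals
    the degree of [arr]^m g^r, with [arr] of degree 18 and g of degree 8. *)
Lemma alpha_symb_pow m r : (r < 3)%N -> alpha_is (symb_pow I3 (3 * m + r)) (18 * m + 8 * r).
Proof.
move=> r3; split; last first.
  move=> f d If f0 fd; have := symb_pow_lower_bound If f0 fd.
  by rewrite [(3 * m)%N]mulnC divnMDl // modnMDl divn_small // modn_small // addn0.
pose g := cub X4 0 1 2 3 * X4 0 * X4 1.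
have X1 i : X4 i \is 1.-homog by rewrite dhomogX /= mdeg1.
have gh : g \is 8.-homog := dhomogM (dhomogM (cub_homog 0 1 2 3) (X1 0)) (X1 1).
exists (arr X4 0 1 2 3 ^+ m * g ^+ r); split; first by apply: symb_pow_arr; apply: I3_mem.
split; last exact: dhomogM (dhomogMn m arr_homog) (dhomogMn r gh).
have c0 : cub X4 0 1 2 3 != 0.
  exact: mulf_neq0 (@X4_cubeB_neq0 0 1 isT) (@X4_cubeB_neq0 2 3 isT).
have g0 : g != 0 := mulf_neq0 (mulf_neq0 c0 (X4_neq0 0)) (X4_neq0 1).
exact: mulf_neq0 (expf_neq0 m arr_neq0) (expf_neq0 r g0).
Qed.

Theorem theorem3p4 :
  (forall m : nat, (1 <= m)%N -> alpha_is (symb_pow I3 (3 * m)) (18 * m)) /\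
  (forall m : nat, alpha_is (symb_pow I3 (3 * m + 1)) (18 * m + 8)) /\
  (forall m : nat, alpha_is (symb_pow I3 (3 * m + 2)) (18 * m + 16)).
Proof.
split; [move=> m _ | split=> m]; last 2 first.
- exact: alpha_symb_pow.
- exact: alpha_symb_pow.
by have := @alpha_symb_pow m 0 isT; rewrite !addn0.
Qed.
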